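(* Let $R$ be a commutative ring and let $\mathcal{W}$ be a self-orthogonal class of $R$-modules which is closed under extensions, finite direct sums and direct summands. For a complex $G$ of $R$-modules, the following are equivalent: (1) $G$ is a C-E $\mathcal{W}$-Gorenstein complex, i.e. $G$, $\mathrm{B}(G)$, $\mathrm{Z}(G)$ and $\mathrm{H}(G)$ are complexes of $\mathcal{W}$-Gorenstein modules. (2) $G$ admits a C-E complete $\mathcal{W}$-resolution.
   Context: A class $\mathcal{W}$ of $R$-modules is self-orthogonal if $\mathrm{Ext}^i_R(W,W')=0$ for all $W,W'\in\mathcal{W}$ and all $i\ge1$. For a complex $X$, $\mathrm{Z}(X),\mathrm{B}(X),\mathrm{H}(X)$ are the complexes (with zero differential) of cycles, boundaries and homology. $\mathcal{C}(R)$ is the category of $R$-complexes, with $\mathrm{Hom}_{\mathcal{C}(R)}$ the group of chain maps. A module $M$ is $\mathcal{W}$-Gorenstein if there is an exact sequence $W_\bullet=\cdots\to W_1\to W_0\to W_{-1}\to W_{-2}\to\cdots$ of modules in $\mathcal{W}$ with $M=\mathrm{Ker}(W_{-1}\to W_{-2})$ such that $\mathrm{Hom}_R(W,W_\bullet)$ and $\mathrm{Hom}_R(W_\bullet,W)$ are exact for all $W\in\mathcal{W}$. A C-E $\mathcal{W}$ complex is a complex $X$ such that all terms of $X,\mathrm{Z}(X),\mathrm{B}(X),\mathrm{H}(X)$ belong to $\mathcal{W}$. A complex of complexes $\cdots\to C^1\to C^0\to C^{-1}\to\cdots$ is C-E exact if it is exact and the induced sequences obtained by applying $\mathrm{Z}(-)$,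 $\mathrm{B}(-)$, $(-)/\mathrm{Z}(-)$, $(-)/\mathrm{B}(-)$ and $\mathrm{H}(-)$ to all $C^i$ are exact. A C-E complete $\mathcal{W}$-resolution of $G$ is a C-E exact sequence $\mathbb{W}=\cdots\to W^1\to W^0\to W^{-1}\to W^{-2}\to\cdots$ of C-E $\mathcal{W}$ complexes with $G=\mathrm{Ker}(W^{-1}\to W^{-2})$ which remains exact after applying $\mathrm{Hom}_{\mathcal{C}(R)}(V,-)$ and $\mathrm{Hom}_{\mathcal{C}(R)}(-,V)$ for every C-E $\mathcal{W}$ complex $V$. *)

(* Defs.v *)
From HB Require Import structures.
From mathcomp Require Import all_boot all_order all_algebra.
From mathcomp Require Import boolp.

Set Implicit Arguments.
Unset Strict Implicit.
Unset Printing Implicit Defensive.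

Import GRing.Theory.
Local Open Scope ring_scope.
Local Open Scope quotient_scope.

Section Submodules.
Variable R : pzRingType.

Record submodule (M : lmodType R) := Submodule {
  submod_carrier :> {pred M};
  submod_carrier_closed : submod_closed submod_carrier }.

HB.instance Definition _ (M : lmodType R) (S : submodule M) :=
  GRing.isSubmodClosed.Build R M (submod_carrier S) (submod_carrier_closed S).

Definition subm (M : lmodType R) (S : submodule M) : Type :=
  {x : M | x \in submod_carrier S}.

HB.instance Definition _ (M : lmodType R) (S : submodule M) :=
  SubType.on (subm S).
HB.instance Definition _ (M : lmodType R) (S : submodule M) :=
  Choice.on (subm S).
HB.instance Definition _ (M : lmodType R) (S : submodule M) :=
  [SubChoice_isSubZmodule of subm S by <:].
HB.instance Definition _ (M : lmodType R) (S : submodule M) :=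
  [SubZmodule_isSubLmodule of subm S by <:].

Definition quom (M : lmodType R) (S : submodule M) : Type :=
  Quotient.quot (submod_carrier S : zmodClosed M).

HB.instance Definition _ (M : lmodType R) (S : submodule M) :=
  ZmodQuotient.on (quom S).

Section QuotientScaling.
Variables (M : lmodType R) (S : submodule M).

Definition quom_scale (a : R) (u : quom S) : quom S :=
  \pi_(quom S) (a *: repr u).

Lemma quom_eq (x y : M) :
  (\pi_(quom S) x = \pi_(quom S) y) <-> (x - y \in S).
Proof.
rewrite (Quotient.idealrBE (submod_carrier S : zmodClosed M)).
by split=> [/eqP|/eqP].
Qed.

Lemma quom_repr (x : M) : repr (\pi_(quom S) x) - x \in S.
Proof. by apply/quom_eq; rewrite reprK. Qed.

Lemma quom_scale_pi a x : quom_scale a (\pi_(quom S) x) = \pi_(quom S) (a *: x).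
Proof. by apply/quom_eq; rewrite -scalerBr rpredZ // quom_repr. Qed.

Lemma quom_scaleA a b u :
  quom_scale a (quom_scale b u) = quom_scale (a * b) u.
Proof. by elim/quotW: u => x; rewrite (quom_scale_pi b) !quom_scale_pi scalerA. Qed.

Lemma quom_scale1 : left_id 1 quom_scale.
Proof. by elim/quotW=> x; rewrite quom_scale_pi scale1r. Qed.

Lemma quom_scaleDr : right_distributive quom_scale +%R.
Proof.
move=> a; elim/quotW=> x; elim/quotW=> y.
by rewrite -raddfD !quom_scale_pi scalerDr raddfD.
Qed.

Lemma quom_scaleDl u : {morph quom_scale^~ u : a b / a + b}.
Proof. by elim/quotW: u => x a b; rewrite !quom_scale_pi scalerDl raddfD. Qed.

HB.instance Definition _ := GRing.Zmodule_isLmodule.Build R (quom S)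
  quom_scaleA quom_scale1 quom_scaleDr quom_scaleDl.

End QuotientScaling.

Section InducedMaps.
Variables (M N : lmodType R) (S : submodule M) (T : submodule N).
Variables (f : {linear M -> N}) (fST : forall x, x \in S -> f x \in T).

Definition subm_map (x : subm S) : subm T := exist _ (f (val x)) (fST (valP x)).

Lemma subm_map_is_linear : linear subm_map.
Proof. by move=> a x y; apply: val_inj; rewrite /= linearP. Qed.

HB.instance Definition _ :=
  GRing.isLinear.Build R (subm S) (subm T) _ subm_map subm_map_is_linear.

#[using="fST"]
Definition quom_map (u : quom S) : quom T := \pi_(quom T) (f (repr u)).

Lemma quom_map_pi x : quom_map (\pi_(quom S) x) = \pi_(quom T) (f x).
Proof. by apply/quom_eq; rewrite -linearB fST // quom_repr. Qed.

Lemma quom_map_is_linear : linear quom_map.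
Proof.
move=> a; elim/quotW=> x; elim/quotW=> y.
have -> : a *: \pi_(quom S) x = \pi_(quom S) (a *: x).
  exact: quom_scale_pi.
rewrite -raddfD !quom_map_pi linearP raddfD; congr (_ + _).
exact/esym/quom_scale_pi.
Qed.

HB.instance Definition _ :=
  GRing.isLinear.Build R (quom S) (quom T) _ quom_map quom_map_is_linear.

End InducedMaps.

Section KernelImage.
Variables (M N : lmodType R) (f : {linear M -> N}).

Lemma ker_closed : submod_closed [pred x | f x == 0].
Proof.
split=> [|a x y]; rewrite !inE ?linear0 // => /eqP fx /eqP fy.
by rewrite linearP fx fy scaler0 addr0.
Qed.

Definition ker := Submodule ker_closed.

Lemma im_closed : submod_closed [pred y | `[< exists x, f x = y >]].
Proof.
split=> [|a y z]; rewrite !inE; first by apply/asboolP; exists 0; rewrite linear0.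
move=> /asboolP[x <-] /asboolP[x' <-]; apply/asboolP.
by exists (a *: x + x'); rewrite linearP.
Qed.

Definition im := Submodule im_closed.

End KernelImage.

Section Restriction.
Variables (M : lmodType R) (S T : submodule M).

Lemma restrict_closed : submod_closed [pred x : subm T | val x \in S].
Proof.
split=> [|a x y]; rewrite !inE; first exact: rpred0.
by move=> xS yS; rewrite linearP rpredD // rpredZ.
Qed.

(* The intersection of S and T, as a submodule of T. *)
Definition restrict := Submodule restrict_closed.

End Restriction.

Definition exact (A B C : lmodType R) (f : {linear A -> B})
    (g : {linear B -> C}) : Prop :=
  forall y, g y = 0 <-> exists x, f x = y.

Definition surj (A B : lmodType R) (f : {linear A -> B}) : Prop :=
  forall y, exists x, f x = y.

End Submodules.

Arguments subm_map {R M N S T} f fST x.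
Arguments quom_map {R M N S T} f fST u.

Section Complexes.
Variable R : pzRingType.

(* Homological grading over the integers.  The differential is indexed by two
   degrees i, j together with a proof of i = j + 1, so that both n -> n - 1 and
   n + 1 -> n are instances of it without any transport between degrees. *)
Record complex := Complex {
  term :> int -> lmodType R;
  diff : forall i j, i = j + 1 -> {linear term i -> term j};
  diff_diff : forall i j k (eij : i = j + 1) (ejk : j = k + 1) x,
    diff ejk (diff eij x) = 0 }.

Definition d_from (X : complex) n : {linear X n -> X (n - 1)} :=
  diff X (esym (subrK 1 n)).

Definition d_to (X : complex) n : {linear X (n + 1) -> X n} :=
  diff X erefl.

Definition exact_complex (X : complex) : Prop :=
  forall n, exact (d_to X n) (d_from X n).

Definition Zsub (X : complex) n : submodule (X n) := ker (d_from X n).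
Definition Bsub (X : complex) n : submodule (X n) := im (d_to X n).

(* Terms of the complexes Z(X), B(X), X/Z(X), X/B(X) and H(X) = Z(X)/B(X);
   the differentials induced on all five are zero. *)
Definition Zt (X : complex) n : lmodType R := subm (Zsub X n).
Definition Bt (X : complex) n : lmodType R := subm (Bsub X n).
Definition XZt (X : complex) n : lmodType R := quom (Zsub X n).
Definition XBt (X : complex) n : lmodType R := quom (Bsub X n).
Definition Ht (X : complex) n : lmodType R :=
  quom (restrict (Bsub X n) (Zsub X n)).

Record chain_map (X Y : complex) := ChainMap {
  cmap :> forall n, {linear X n -> Y n};
  cmap_diff : forall i j (e : i = j + 1) x,
    cmap j (diff X e x) = diff Y e (cmap i x) }.

Section Functoriality.
Variables (X Y : complex) (f : chain_map X Y) (n : int).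

Lemma cmap_Z x : x \in Zsub X n -> f n x \in Zsub Y n.
Proof. by rewrite !inE => /eqP dx; rewrite -cmap_diff dx linear0. Qed.

Lemma cmap_B x : x \in Bsub X n -> f n x \in Bsub Y n.
Proof.
rewrite !inE => /asboolP[y <-]; apply/asboolP.
by exists (f (n + 1) y); rewrite -cmap_diff.
Qed.

Definition Zmap : {linear Zt X n -> Zt Y n} := subm_map (f n) cmap_Z.
Definition Bmap : {linear Bt X n -> Bt Y n} := subm_map (f n) cmap_B.
Definition XZmap : {linear XZt X n -> XZt Y n} := quom_map (f n) cmap_Z.
Definition XBmap : {linear XBt X n -> XBt Y n} := quom_map (f n) cmap_B.

Lemma Zmap_B (x : Zt X n) :
  x \in restrict (Bsub X n) (Zsub X n) ->
  Zmap x \in restrict (Bsub Y n) (Zsub Y n).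
Proof. exact: cmap_B. Qed.

Definition Hmap : {linear Ht X n -> Ht Y n} := quom_map Zmap Zmap_B.

End Functoriality.

(* A complex of complexes, i.e. a complex in the category of complexes. *)
Record ccomplex := CComplex {
  cterm :> int -> complex;
  cdiff : forall p q, p = q + 1 -> chain_map (cterm p) (cterm q);
  cdiff_diff : forall p q r (epq : p = q + 1) (eqr : q = r + 1) n x,
    cdiff eqr n (cdiff epq n x) = 0 }.

Definition cd_from (C : ccomplex) p : chain_map (C p) (C (p - 1)) :=
  cdiff C (esym (subrK 1 p)).

Definition cd_to (C : ccomplex) p : chain_map (C (p + 1)) (C p) :=
  cdiff C erefl.

Definition CE_exact (C : ccomplex) : Prop :=
  forall p n,
  [/\ exact (cd_to C p n) (cd_from C p n),
      exact (Zmap (cd_to C p) n) (Zmap (cd_from C p) n)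
    & exact (Bmap (cd_to C p) n) (Bmap (cd_from C p) n)] /\
  [/\ exact (XZmap (cd_to C p) n) (XZmap (cd_from C p) n),
      exact (XBmap (cd_to C p) n) (XBmap (cd_from C p) n)
    & exact (Hmap (cd_to C p) n) (Hmap (cd_from C p) n)].

End Complexes.

Section Ext.
Variable R : pzRingType.

Definition projective (P : lmodType R) : Prop :=
  forall (A B : lmodType R) (g : {linear A -> B}) (h : {linear P -> B}),
    surj g -> exists k : {linear P -> A}, forall x, g (k x) = h x.

Record proj_resolution (M : lmodType R) := ProjResolution {
  rterm :> nat -> lmodType R;
  rdiff : forall n, {linear rterm n.+1 -> rterm n};
  raug : {linear rterm 0 -> M};
  rproj : forall n, projective (rterm n);
  raug_surj : surj raug;
  raug_exact : exact (rdiff 0) raug;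
  rdiff_exact : forall n, exact (rdiff n.+1) (rdiff n) }.

(* Ext^(n+1)_R(M, N) = 0: the complex Hom_R(P, N) is exact in degree n + 1, for
   some projective resolution P of M (and hence for every one, as cohomology
   does not depend on the resolution). *)
Definition ExtS_eq0 (n : nat) (M N : lmodType R) : Prop :=
  exists P : proj_resolution M,
  forall f : {linear P n.+1 -> N}, (forall x, f (rdiff P n.+1 x) = 0) ->
  exists g : {linear P n -> N}, forall x, g (rdiff P n x) = f x.

End Ext.

Section Classes.
Variables (R : pzRingType) (W : lmodType R -> Prop).

Definition self_orthogonal : Prop :=
  forall M N, W M -> W N -> forall n, ExtS_eq0 n M N.

Definition closed_extensions : Prop :=
  forall (A E B : lmodType R) (f : {linear A -> E}) (g : {linear E -> B}),
    injective f -> exact f g -> surj g -> W A -> W B -> W E.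

(* S is the direct sum of the finite family M, via the injections in_. *)
Definition is_direct_sum (I : finType) (M : I -> lmodType R) (S : lmodType R)
    (in_ : forall i, {linear M i -> S}) : Prop :=
  forall s, exists! m : forall i, M i, s = \sum_i in_ i (m i).

Definition closed_finite_direct_sums : Prop :=
  forall (I : finType) (M : I -> lmodType R) (S : lmodType R)
         (in_ : forall i, {linear M i -> S}),
    is_direct_sum in_ -> (forall i, W (M i)) -> W S.

(* With N' = 0 this includes invariance under isomorphism. *)
Definition closed_direct_summands : Prop :=
  forall (M N N' : lmodType R) (f : {linear (N * N')%type -> M}),
    bijective f -> W M -> W N.

Definition Hom_from_exact (V : lmodType R) (X : complex R) : Prop :=
  forall n (f : {linear V -> X n}), (forall v, d_from X n (f v) = 0) ->
  exists g : {linear V -> X (n + 1)}, forall v, d_to X n (g v) = f v.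

Definition Hom_to_exact (X : complex R) (V : lmodType R) : Prop :=
  forall n (f : {linear X n -> V}), (forall x, f (d_to X n x) = 0) ->
  exists g : {linear X (n - 1) -> V}, forall x, g (d_from X n x) = f x.

Definition Gorenstein (M : lmodType R) : Prop :=
  exists (X : complex R) (k : {linear M -> X (-1)}),
  [/\ forall n, W (X n),
      exact_complex X,
      injective k /\ exact k (d_from X (-1)),
      forall V, W V -> Hom_from_exact V X
    & forall V, W V -> Hom_to_exact X V].

Definition CE_class (X : complex R) : Prop :=
  forall n, [/\ W (X n), W (Zt X n), W (Bt X n) & W (Ht X n)].

Definition CE_Gorenstein (G : complex R) : Prop :=
  forall n, [/\ Gorenstein (G n), Gorenstein (Bt G n),
                Gorenstein (Zt G n) & Gorenstein (Ht G n)].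

Definition cHom_from_exact (V : complex R) (C : ccomplex R) : Prop :=
  forall p (f : chain_map V (C p)), (forall n v, cd_from C p n (f n v) = 0) ->
  exists g : chain_map V (C (p + 1)), forall n v, cd_to C p n (g n v) = f n v.

Definition cHom_to_exact (C : ccomplex R) (V : complex R) : Prop :=
  forall p (f : chain_map (C p) V), (forall n x, f n (cd_to C p n x) = 0) ->
  exists g : chain_map (C (p - 1)) V, forall n x, g n (cd_from C p n x) = f n x.

Definition CE_complete_resolution (G : complex R) (C : ccomplex R) : Prop :=
  [/\ CE_exact C,
      forall p, CE_class (C p),
      exists k : chain_map G (C (-1)),
        forall n, injective (k n) /\ exact (k n) (cd_from C (-1) n),
      forall V, CE_class V -> cHom_from_exact V C
    & forall V, CE_class V -> cHom_to_exact C V].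

End Classes.

(* Main.v *)
Require Import Defs.
From HB Require Import structures.
From mathcomp Require Import all_boot all_order all_algebra.
From mathcomp Require Import boolp.

(** Write Z, B and H for cycles, boundaries and homology.

    The homological input is that a W-Gorenstein module M satisfies
    Ext^1(M, V) = 0 and Ext^1(V, M) = 0 for every V in W
    ([Gorenstein_ext1], [ext1_Gorenstein]); both follow by dimension shifting
    along a complete resolution of M.  The vanishing of Ext^1 is used through
    the extension property [ext1_vanishes] and the lifting property [lifts].

    The test objects are the complexes [std S Q], with
    S (n + 1) + Q n + S n in degree n and a differential that carries the last
    summand of degree n to the first summand of degree n - 1: sums of disks on
    S and of spheres on Q.  A chain map from [std S Q] to X amounts to linear
    maps S n -> X n and Q n -> Z_n(X), and a chain map from X to [std S Q]
    amounts to linear maps X n -> S (n + 1) and X n / B_n(X) -> Q n.  When S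
    and Q take values in W these are C-E W complexes, and every C-E W complex
    X is a retract of one of them, as 0 -> B_n -> Z_n -> H_n -> 0 and
    0 -> Z_n -> X_n -> B_(n-1) -> 0 split ([CE_class_retract]).

    From (1) to (2), a complex K with Gorenstein boundaries and homology embeds
    into some V = [std S Q], where S and Q are built from the first terms of
    complete resolutions of the B_n(K) and H_n(K): these maps extend from B_n
    and Z_n to K_n because Ext^1 vanishes.  The cokernel L has as boundaries
    and homology the cosyzygies of those of K, so it is of the same kind
    ([cosyzygy_step]); dually on the other side ([syzygy_step]).  Iterating in
    both directions and splicing gives the resolution.  The sequences
    0 -> K -> V -> L -> 0 are exact on cycles too, which forces exactness of
    all the functors in the definition of C-E exactness, and they stay exact
    under Hom from and into C-E W complexes ([CE_lift], [CE_extend]).  Carrying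
    only B and H through the iteration, instead of all four classes of
    modules, makes the induction independent of the closure of Gorenstein
    modules under extensions.

    From (2) to (1), C-E exactness says that the components X_n, Z_n, B_n and
    H_n of the resolution are exact complexes of modules of W, with the right
    kernels.  Testing against [std] complexes yields exactness of Hom(V, -) on
    the X_n and Z_n, and of Hom(-, V) on the X_n and X_n / B_n; the remaining
    cases follow along short exact sequences of complexes
    ([Hom_from_quotient], [Hom_to_sub]). *)

Set Implicit Arguments.
Unset Strict Implicit.
Unset Printing Implicit Defensive.

Import GRing.Theory.
Local Open Scope ring_scope.
Local Open Scope quotient_scope.

(** * Linear maps and vanishing of Ext^1 *)

Section Modules.
Variable R : pzRingType.

(** Diagram chases define maps by relations of this kind.  Since the relation
    is linear, being single-valued only has to be checked at 0. *)
Lemma linear_of_relation (A B : lmodType R) (r : A -> B -> Prop) :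
    (forall x, exists y, r x y) ->
    (forall a x y x' y', r x y -> r x' y' -> r (a *: x + x') (a *: y + y')) ->
    (forall y, r 0 y -> y = 0) ->
  exists k : {linear A -> B}, forall x y, r x y <-> k x = y.
Proof.
move=> tot lin r0.
have fr x y y' : r x y -> r x y' -> y = y'.
  move=> rxy rxy'; apply/eqP; rewrite eq_sym -subr_eq0; apply/eqP/r0.
  by have := lin (-1) _ _ _ _ rxy rxy'; rewrite !scaleN1r addNr addrC.
pose f x := projT1 (cid (tot x)).
have fP x : r x (f x) by rewrite /f; case: cid.
have lf : linear f by move=> a x y; apply: fr (fP _) _; apply: lin.
pose fl := GRing.isLinear.Build R A B _ f lf.
pose k : {linear A -> B} := HB.pack f fl.
exists k => x y; split=> [rxy|<-]; last exact: fP.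
exact: fr (fP x) rxy.
Qed.

Lemma linear_of_fun (A B : lmodType R) (f : A -> B) :
  linear f -> exists k : {linear A -> B}, k =1 f.
Proof.
move=> lf; pose fl := GRing.isLinear.Build R A B _ f lf.
by exists (HB.pack f fl : {linear A -> B}).
Qed.

Lemma kerP (M N : lmodType R) (f : {linear M -> N}) x :
  x \in ker f <-> f x = 0.
Proof. by rewrite inE; split=> [/eqP|->]. Qed.

Lemma imP (M N : lmodType R) (f : {linear M -> N}) y :
  y \in im f <-> exists x, f x = y.
Proof. by rewrite inE; split=> /asboolP. Qed.

Section Quotients.
Variables (M : lmodType R) (S : submodule M).

Definition quom_pi (x : M) : quom S := \pi_(quom S) x.

Lemma quom_pi_is_linear : linear quom_pi.
Proof.
move=> a x y; rewrite /quom_pi raddfD; congr (_ + _).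
exact/esym/quom_scale_pi.
Qed.

HB.instance Definition _ :=
  GRing.isLinear.Build R M (quom S) _ quom_pi quom_pi_is_linear.

Lemma quom_pi_surj : surj quom_pi.
Proof. by elim/quotW=> x; exists x. Qed.

Lemma quom_pi_eq0 x : quom_pi x = 0 <-> x \in S.
Proof. by rewrite -(linear0 quom_pi) quom_eq subr0. Qed.

Definition subm_val (x : subm S) : M := val x.

Lemma subm_val_is_linear : linear subm_val.
Proof. by []. Qed.

HB.instance Definition _ :=
  GRing.isLinear.Build R (subm S) M _ subm_val subm_val_is_linear.

Lemma subm_val_inj : injective subm_val.
Proof. exact: val_inj. Qed.

Lemma subm_valP x : x \in S <-> exists u, subm_val u = x.
Proof. by split=> [xS|[u <-]]; [exists (exist _ x xS)|exact: (valP u)]. Qed.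

End Quotients.

Lemma inj0 (A B : lmodType R) (f : {linear A -> B}) x :
  injective f -> f x = 0 -> x = 0.
Proof. by move=> fi fx; apply: fi; rewrite fx linear0. Qed.

Lemma linear_inj (A B : lmodType R) (f : {linear A -> B}) :
  (forall x, f x = 0 -> x = 0) -> injective f.
Proof. exact: raddf_inj. Qed.

Lemma factor_surj (A B C : lmodType R) (p : {linear A -> B})
    (h : {linear A -> C}) :
    surj p -> (forall a, p a = 0 -> h a = 0) ->
  exists k : {linear B -> C}, forall a, k (p a) = h a.
Proof.
move=> ps ph.
have [||_ [a [pa ->]]|k kP] := @linear_of_relation B C
  (fun b c => exists a, p a = b /\ c = h a).
- by move=> b; have [a pa] := ps b; exists (h a), a.
- move=> a _ _ _ _ [x [<- ->]] [y [<- ->]]; exists (a *: x + y).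
  by rewrite !linearP.
- exact: ph.
by exists k => a; apply/kP; exists a.
Qed.

Lemma factor_inj (A B C : lmodType R) (i : {linear B -> C})
    (h : {linear A -> C}) :
    injective i -> (forall a, exists b, i b = h a) ->
  exists k : {linear A -> B}, forall a, i (k a) = h a.
Proof.
move=> ii ih.
have [||b|k kP] := @linear_of_relation A B (fun a b => i b = h a).
- exact: ih.
- by move=> a x y x' y' e e'; rewrite !linearP e e'.
- by rewrite linear0; apply: inj0.
by exists k => a; apply/kP.
Qed.

Lemma pullback (E C B : lmodType R) (g : {linear E -> B})
    (v : {linear C -> B}) :
  exists (P : lmodType R) (p1 : {linear P -> E}) (p2 : {linear P -> C}),
  [/\ forall p, g (p1 p) = v (p2 p),
      forall e c, g e = v c -> exists p, p1 p = e /\ p2 p = c,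
      forall p q, p1 p = p1 q -> p2 p = p2 q -> p = q
    & forall (A : lmodType R) (a1 : {linear A -> E}) (a2 : {linear A -> C}),
        (forall x, g (a1 x) = v (a2 x)) ->
      exists l : {linear A -> P}, forall x, p1 (l x) = a1 x /\ p2 (l x) = a2 x].
Proof.
have [|d dE] := @linear_of_fun (E * C)%type B (fun x => g x.1 - v x.2).
  move=> a x y; rewrite linearD linearZ /= linearD linearZ opprD scalerBr.
  exact: addrACA.
pose s := subm_val (S := ker d); pose p1 := fst \o s; pose p2 := snd \o s.
have sat p : g (p1 p) = v (p2 p).
  by apply/eqP; rewrite -subr_eq0 -dE; apply/eqP/kerP/subm_valP; exists p.
have ex e c : g e = v c -> exists p, p1 p = e /\ p2 p = c.
  move=> gv; have /subm_valP[p pE] : (e, c) \in ker d.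
    by apply/kerP; rewrite dE gv subrr.
  by exists p; rewrite /p1 /p2 /s /= pE.
have uni p q : p1 p = p1 q -> p2 p = p2 q -> p = q.
  move=> e1 e2; apply: subm_val_inj.
  by rewrite [LHS]surjective_pairing [RHS]surjective_pairing; congr pair.
exists (subm (ker d)), p1, p2; split=> // A a1 a2 ga.
have [|||l lP] := @linear_of_relation A (subm (ker d))
  (fun x p => p1 p = a1 x /\ p2 p = a2 x).
- by move=> x; apply: ex.
- move=> r x p y q [h1 h2] [h3 h4]; rewrite !linearP -h1 -h2 -h3 -h4.
  by split; apply: linearP.
- have [p10 p20] : p1 0 = 0 /\ p2 0 = 0 by [].
  by move=> p []; rewrite !linear0 => h1 h2; apply: uni; rewrite ?h1 ?h2.
by exists l => x; apply/lP.
Qed.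

Lemma kernel (A B : lmodType R) (f : {linear A -> B}) :
  exists (K : lmodType R) (s : {linear K -> A}), injective s /\ exact s f.
Proof.
exists (subm (ker f)), (subm_val (S := ker f)); split; first exact: subm_val_inj.
by move=> x; rewrite -subm_valP kerP.
Qed.

Lemma cokernel (A B : lmodType R) (f : {linear A -> B}) :
  exists (C : lmodType R) (q : {linear B -> C}), exact f q /\ surj q.
Proof.
exists (quom (im f)), (quom_pi (im f)); split; last exact: quom_pi_surj.
by move=> x; rewrite quom_pi_eq0 imP.
Qed.

(** Ext^1(C, V) = 0, in Yoneda form.  The map [f] may have a kernel: the
    condition on [h] makes [h] factor through the image of [f], so the extension
    in question is the one of C by that image. *)
Definition ext1_vanishes (C V : lmodType R) : Prop :=
  forall (A E : lmodType R) (f : {linear A -> E}) (g : {linear E -> C}),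
    exact f g -> surj g ->
  forall h : {linear A -> V}, (forall a, f a = 0 -> h a = 0) ->
  exists k : {linear E -> V}, forall a, k (f a) = h a.

(** Ext^1(C, M) = 0, read in the second argument.  The map [v] only has to land
    in the image of [g], so B need not be replaced by that image. *)
Definition lifts (C M : lmodType R) : Prop :=
  forall (E B : lmodType R) (f : {linear M -> E}) (g : {linear E -> B}),
    injective f -> exact f g ->
  forall v : {linear C -> B}, (forall c, exists e, g e = v c) ->
  exists l : {linear C -> E}, forall c, g (l c) = v c.

(** Lift the augmentation of the resolution P to e : P_0 -> E.  Then e sends
    boundaries into the image of f, and h turns this into a cocycle
    u : P_1 -> V.  If u is the coboundary of g' : P_0 -> V, then
    e p + f a |-> g' p + h a is well defined on E. *)
Lemma ext1_vanishes_resolution (C V : lmodType R) :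
  ExtS_eq0 0 C V -> ext1_vanishes C V.
Proof.
case=> P extP A E f g fg gs h fh.
have [e eP] := @rproj _ _ P 0 _ _ g (raug P) gs.
have eim y : exists a, f a = e (rdiff P 0 y).
  by apply/fg; rewrite eP; apply/raug_exact; exists y.
have [||_ [a [fa ->]]|u uP] := @linear_of_relation (P 1) V
  (fun y v => exists a, f a = e (rdiff P 0 y) /\ v = h a).
- by move=> y; have [a fa] := eim y; exists (h a), a.
- move=> r x _ y _ [a [fa ->]] [b [fb ->]]; exists (r *: a + b).
  by rewrite !linearP fa fb.
- by apply: fh; rewrite fa !linear0.
have [|g' g'P] := extP u.
  move=> x; apply/uP; exists 0; rewrite !linear0; split=> //.
  have -> : rdiff P 0 (rdiff P 1 x) = 0 by apply/rdiff_exact; exists x.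
  by rewrite linear0.
have [||_ [p [a [pa ->]]]|k kP] := @linear_of_relation E V
  (fun x v => exists p a, x = e p + f a /\ v = g' p + h a).
- move=> x; have [p pE] := raug_surj P (g x).
  have [|a fa] := (fg (x - e p)).1; first by rewrite linearB eP pE subrr.
  by exists (g' p + h a), p, a; rewrite fa addrC subrK.
- move=> r _ _ _ _ [p [a [-> ->]]] [q [b [-> ->]]].
  exists (r *: p + q), (r *: a + b); rewrite !linearP !scalerDr.
  by split; rewrite addrACA.
- have /raug_exact[y yp] : raug P p = 0.
    have: g (e p + f a) = 0 by rewrite -pa linear0.
    by rewrite linearD eP (_ : g (f a) = 0) ?addr0 //; apply/fg; exists a.
  rewrite -yp g'P; have [b fb] := eim y.
  have -> : u y = h b by apply/uP; exists b.
  by rewrite -linearD fh // linearD fb yp.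
exists k => a; apply/kP; exists 0, a.
by rewrite !linear0 !add0r.
Qed.

(** Pull the extension of B by M back along v.  Extending the identity of M
    gives a retraction r of the pullback onto M, and the kernel of r is the graph
    of the required lift. *)
Lemma ext1_vanishes_lifts (C M : lmodType R) : ext1_vanishes C M -> lifts C M.
Proof.
move=> extCM E B f g fi fg v vg.
have [P [p1 [p2 [gv pP pI pU]]]] := pullback g v.
have [m|f' f'P] := pU M f \0; first by rewrite linear0; apply/fg; exists m.
have [|||r rP] := extCM _ _ f' p2 _ _ (idfun : {linear M -> M}).
- move=> p; split=> [p2p|[m <-]]; last by have [] := f'P m.
  have /fg[m fm] : g (p1 p) = 0 by rewrite gv p2p linear0.
  by exists m; have [e1 e2] := f'P m; apply: pI; rewrite ?e1 ?e2 ?fm ?p2p.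
- by move=> c; have [e ge] := vg c; have [p []] := pP _ _ ge; exists p.
- by move=> m /= fm0; apply: (inj0 fi); have [<- _] := f'P m; rewrite fm0 linear0.
have [|||l lP] := @linear_of_relation C E
  (fun c e => exists p, [/\ p1 p = e, p2 p = c & r p = 0]).
- move=> c; have [e ge] := vg c; have [p [p1p p2p]] := pP _ _ ge.
  exists (p1 (p - f' (r p))), (p - f' (r p)); split=> //.
    by rewrite linearB p2p; have [_ ->] := f'P (r p); rewrite subr0.
  by rewrite linearB rP subrr.
- move=> a _ _ _ _ [p [<- <- rp]] [q [<- <- rq]].
  by exists (a *: p + q); rewrite !linearP rp rq scaler0 addr0.
- move=> _ [p [<- p2p rp]].
  have /fg[m fm] : g (p1 p) = 0 by rewrite gv p2p linear0.
  have pE : p = f' m.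
    by have [e1 e2] := f'P m; apply: pI; rewrite ?e1 ?e2 ?fm ?p2p.
  by rewrite -fm; move: rp; rewrite pE rP /= => ->; rewrite linear0.
exists l => c; have [p [<- <- _]] := (lP c (l c)).2 erefl.
exact: gv.
Qed.

Definition short_exact (A B C : lmodType R) (f : {linear A -> B})
    (g : {linear B -> C}) : Prop :=
  [/\ injective f, exact f g & surj g].

(** The map is extended first to the preimage of A in the extension, where only
    Ext^1(A, V) matters, and from there to the whole extension. *)
Lemma ext1_vanishes_ext (A B C V : lmodType R) (i : {linear A -> B})
    (p : {linear B -> C}) :
  short_exact i p -> ext1_vanishes A V -> ext1_vanishes C V ->
  ext1_vanishes B V.
Proof.
move=> [ii ip ps] extA extC A' E f g fg gs h fh.
have [S [s [si sP]]] := kernel (p \o g).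
have [||f' f'P] := @factor_inj _ _ _ s f.
- exact: si.
- move=> a; apply/sP => /=.
  have -> : g (f a) = 0 by apply/fg; exists a.
  exact: linear0.
have [u|g' g'P] := @factor_inj _ _ _ i (g \o s) ii.
  by apply/ip/sP; exists u.
have [||a|k' k'P] := extA _ _ f' g' _ _ h.
- move=> u; split=> [gu|[a <-]].
    have /fg[a fa] : g (s u) = 0 by rewrite -[LHS]g'P gu linear0.
    by exists a; apply: si; rewrite f'P.
  apply: (inj0 ii); rewrite g'P /= f'P.
  by apply/fg; exists a.
- move=> a; have [x gx] := gs (i a).
  have /sP[u su] : p (g x) = 0 by rewrite gx; apply/ip; exists a.
  by exists u; apply: ii; rewrite g'P /= su.
- by move=> f'a; apply: fh; rewrite -f'P f'a linear0.
have [||u|k kP] := extC _ _ s (p \o g) _ _ k'.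
- exact: sP.
- by move=> c; have [b <-] := ps c; have [x <-] := gs b; exists x.
- by move=> /(inj0 si) ->; rewrite linear0.
by exists k => a; rewrite -k'P -kP; congr (k _); rewrite -f'P.
Qed.

(** The map is lifted first to the quotient of the extension by A, and then
    along the projection onto that quotient, whose kernel is A. *)
Lemma lifts_ext (A B C V : lmodType R) (i : {linear A -> B})
    (p : {linear B -> C}) :
  short_exact i p -> lifts V A -> lifts V C -> lifts V B.
Proof.
move=> [ii ip ps] liftA liftC E X f g fi fg v vg.
have [S [q [qP qs]]] := cokernel (f \o i).
have [b /ip[a <-]|f' f'P] := @factor_surj _ _ _ p (q \o f) ps.
  by apply/qP; exists a.
have [x /qP[a <-]|g' g'P] := @factor_surj _ _ _ q g qs.
  by apply/fg; exists (i a).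
have [|||v' v'P] := liftC _ _ f' g' _ _ v.
- apply: linear_inj => c; have [b <-] := ps c; rewrite f'P => /qP[a].
  by move=> /fi <-; apply/ip; exists a.
- move=> y; have [x <-] := qs y; rewrite g'P; split=> [/fg[b <-]|[c]].
    by exists (p b); rewrite f'P.
  have [b <-] := ps c; rewrite f'P /= => /eqP; rewrite -subr_eq0 -linearB.
  move=> /eqP/qP[a /= fa]; apply/fg; exists (b - i a).
  by rewrite linearB fa subKr.
- by move=> c; have [x <-] := vg c; exists (q x); rewrite g'P.
have [|||l lP] := liftA _ _ (f \o i) q _ _ v'.
- exact: inj_comp.
- exact: qP.
- by move=> c; apply: qs.
by exists l => c; rewrite -g'P lP v'P.
Qed.

End Modules.

(** * Gorenstein modules *)

Section ModuleComplexes.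
Variable R : pzRingType.

Lemma diff_irr (X : complex R) i j (e e' : i = j + 1) : diff X e = diff X e'.
Proof. by congr diff; apply: eq_irrelevance. Qed.

Arguments diff_irr {X i j} e e'.

Lemma eq_pred (i j : int) : i = j + 1 -> j = i - 1.
Proof. by move->; rewrite addrK. Qed.

Lemma eq_succ_pred (m : int) : m = m - 1 + 1.
Proof. by rewrite subrK. Qed.

Lemma exact_diff (X : complex R) i j k (e1 : i = j + 1) (e2 : j = k + 1) :
  exact_complex X -> exact (diff X e1) (diff X e2).
Proof.
move=> exX; subst i; have kE := eq_pred e2; subst k.
by have := exX j; rewrite /d_to /d_from (diff_irr (esym _) e2).
Qed.

Lemma Hom_from_diff (V : lmodType R) (X : complex R) i j k
    (e1 : i = j + 1) (e2 : j = k + 1) (f : {linear V -> X j}) :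
    Hom_from_exact V X -> (forall v, diff X e2 (f v) = 0) ->
  exists g : {linear V -> X i}, forall v, diff X e1 (g v) = f v.
Proof.
move=> exX f0; subst i; have kE := eq_pred e2; subst k; apply: exX => v.
by rewrite /d_from (diff_irr (esym _) e2).
Qed.

Lemma Hom_to_diff (V : lmodType R) (X : complex R) i j k
    (e1 : i = j + 1) (e2 : j = k + 1) (f : {linear X j -> V}) :
    Hom_to_exact X V -> (forall x, f (diff X e1 x) = 0) ->
  exists g : {linear X k -> V}, forall x, g (diff X e2 x) = f x.
Proof.
move=> exX; subst i; have kE := eq_pred e2; subst k => /exX[g gP].
by exists g => x; rewrite -gP /d_from (diff_irr (esym _) e2).
Qed.

Lemma shift_succ (c i j : int) : i = j + 1 -> i + c = j + c + 1.
Proof. by move->; rewrite addrAC. Qed.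

Definition shift (X : complex R) (c : int) : complex R :=
  @Complex R (fun n => X (n + c)) (fun i j e => diff X (shift_succ c e))
    (fun i j k eij ejk =>
       diff_diff (shift_succ c eij) (shift_succ c ejk)).

Variable W : lmodType R -> Prop.
Hypothesis extWW : forall V V', W V -> W V' -> ext1_vanishes V V'.

Lemma Gorenstein_shift (X : complex R) (c : int) (M : lmodType R)
    (k : {linear M -> X (-1 + c)}) :
    (forall n, W (X n)) -> exact_complex X ->
    (forall V, W V -> Hom_from_exact V X) ->
    (forall V, W V -> Hom_to_exact X V) ->
    injective k -> exact k (diff X (shift_succ c (esym (subrK 1 (-1))))) ->
  Gorenstein W M.
Proof.
move=> WX exX fromX toX ki kd; exists (shift X c), k; split=> //.
- by move=> n; apply: (WX (n + c)).
- by move=> n; have := exact_diff (shift_succ c (erefl (n + 1)))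
    (shift_succ c (esym (subrK 1 n))) exX.
- move=> V WV n f f0.
  by apply: (@Hom_from_diff V X _ _ _ (shift_succ c _) (shift_succ c _)) f0; apply: fromX.
- move=> V WV n f f0.
  by apply: (@Hom_to_diff V X _ _ _ (shift_succ c _) (shift_succ c _)) f0; apply: toX.
Qed.

(** The cokernel M' is universally quantified so that the result applies to any
    module isomorphic to a cosyzygy, such as a boundary or homology module of a
    quotient complex. *)
Lemma Gorenstein_cosyzygy (M : lmodType R) : Gorenstein W M ->
  exists (V : lmodType R) (i : {linear M -> V}),
  [/\ W V, injective i
    & forall (M' : lmodType R) (p : {linear V -> M'}),
        exact i p -> surj p -> Gorenstein W M'].
Proof.
case=> X [k [WX exX [ki kd] fromX toX]]; exists (X (-1)), k; split=> // M' p kp ps.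
have [a /kp/kd //|k' k'P] := @factor_surj _ _ _ _ p (d_from X (-1)) ps.
apply: (@Gorenstein_shift X (-1) M' k') => //.
- apply: linear_inj => m; have [x <-] := ps m; rewrite k'P => /kd ?.
  exact/kp.
- move=> y; rewrite (exact_diff (esym (subrK 1 (-1))) _ exX).
split=> [[x <-]|[m <-]]; first by exists (p x); rewrite k'P.
by have [x <-] := ps m; exists x; rewrite k'P.
Qed.

Lemma Gorenstein_syzygy (M : lmodType R) : Gorenstein W M ->
  exists (V : lmodType R) (p : {linear V -> M}),
  [/\ W V, surj p
    & forall (M' : lmodType R) (i : {linear M' -> V}),
        injective i -> exact i p -> Gorenstein W M'].
Proof.
case=> X [k [WX exX [ki kd] fromX toX]].
have [x|p pP] := @factor_inj _ _ _ _ k (d_to X (-1)) ki.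
  by apply/kd/exX; exists x.
exists (X (-1 + 1)), p; split=> // [m|M' i ii ip].
  have /exX[x xm] : d_from X (-1) (k m) = 0 by apply/kd; exists m.
  by exists x; apply: ki; rewrite pP.
apply: (@Gorenstein_shift X 1 M' i) => // y.
rewrite -ip (_ : diff X _ y = d_to X (-1) y); last first.
  (* The degree -1 - 1 + 1 computes to -1: both sides are the differential
     X (-1 + 1) -> X (-1), for two proofs of the same equation. *)
  exact: (congr1 (fun h : {linear _ -> _} => h y) (@diff_irr X _ (-1) _ _)).
rewrite -pP; split=> [/(inj0 ki)//|->]; exact: linear0.
Qed.

(** Let p : X_0 -> M be the end of the resolution of M, with kernel M_1.  As
    Ext^1(X_0, V) = 0, the map h extends to the pullback of E along p.  The
    restriction of this extension to M_1 extends to w : X_0 -> V because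
    Hom(X, V) is exact.  Subtracting w gives a map that vanishes on M_1, hence
    descends to E. *)
Lemma Gorenstein_ext1 (M V : lmodType R) :
  Gorenstein W M -> W V -> ext1_vanishes M V.
Proof.
case=> X [k [WX exX [ki kd] fromX toX]] WV A E f g fg gs h fh.
have [x|p pP] := @factor_inj _ _ _ _ k (d_to X (-1)) ki.
  by apply/kd/exX; exists x.
have ps : surj p.
  move=> m; have /exX[x xm] : d_from X (-1) (k m) = 0 by apply/kd; exists m.
  by exists x; apply: ki; rewrite pP.
have [P [p1 [p2 [gv pS pI pU]]]] := pullback g p.
have [a|f' f'P] := pU A f \0; first by rewrite linear0; apply/fg; exists a.
have kerp2 x : p2 x = 0 <-> exists a, f' a = x.
  split=> [p2x|[a <-]]; last by have [_ ->] := f'P a.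
  have /fg[a fa] : g (p1 x) = 0 by rewrite gv p2x linear0.
  by exists a; have [e1 e2] := f'P a; apply: pI; rewrite ?e1 ?e2.
have [x||h1 h1P] := extWW (WX _) WV kerp2 _ (h := h).
- by have [e ge] := gs (p x); have [z [_ <-]] := pS _ _ ge; exists z.
- by move=> a f'a; apply: fh; have [<- _] := f'P a; rewrite f'a linear0.
have exd := exact_diff (erefl : -1 + 1 + 1 = _) (erefl : -1 + 1 = _) exX.
have kerp x : p x = 0 <-> exists y, d_to X (-1 + 1) y = x.
  rewrite -exd -[diff X _ x]/(d_to X _ x) -pP.
  by split=> [->|/(inj0 ki)//]; apply: linear0.
have [y|j jP] := pU (X (-1 + 1 + 1)) \0 (d_to X (-1 + 1)).
  by rewrite linear0; apply/esym/kerp; exists y.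
have [x|w wP] := @Hom_to_diff V X _ _ _ (erefl : -1 + 1 + 1 + 1 = _)
    (erefl : -1 + 1 + 1 = _) (h1 \o j) (toX _ WV).
  rewrite /= (_ : j _ = 0) ?linear0 //; apply: pI; rewrite linear0.
    by have [-> _] := jP (diff X erefl x).
  by have [_ ->] := jP (diff X erefl x); rewrite /d_to diff_diff.
have kerp1 z : p1 z = 0 -> h1 z - w (p2 z) = 0.
  move=> p1z; have /kerp[x xz] : p (p2 z) = 0 by rewrite -gv p1z linear0.
  have -> : z = j x by have [e1 e2] := jP x; apply: pI; rewrite ?e1 ?e2.
  by have [_ ->] := jP x; rewrite /d_to wP /= subrr.
have [||k' k'P] := @factor_surj _ _ _ _ p1 (h1 \- (w \o p2)).
- by move=> e; have [x px] := ps (g e); have [z [<- _]] := pS _ _ (esym px); exists z.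
- by move=> z /kerp1.
exists k' => a; have [<- p2f] := f'P a.
by rewrite k'P /= p2f linear0 subr0.
Qed.

(** As Ext^1(V, X_(-1)) = 0, the composite A -> M -> X_(-1) extends to E.  The
    obstruction for this extension to land in M is a map w : V -> X_(-2) killed
    by the differential; it lifts to X_(-1) because Hom(V, X) is exact, and
    subtracting the lift removes the obstruction. *)
Lemma ext1_Gorenstein (M V : lmodType R) :
  Gorenstein W M -> W V -> ext1_vanishes V M.
Proof.
case=> X [k [WX exX [ki kd] fromX toX]] WV A E f g fg gs h fh.
have [a fa0|k1 k1P] := extWW WV (WX (-1)) fg gs (h := k \o h).
  by rewrite /= fh // linear0.
have [e /fg[a <-]|w wP] := @factor_surj _ _ _ _ g (d_from X (-1) \o k1) gs.
  by rewrite /= k1P; apply/kd; exists (h a).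
have [v|w' w'P] := @Hom_from_diff V X _ _ _ (esym (subrK 1 (-1)))
   (esym (subrK 1 (-1 - 1))) w (fromX _ WV).
  by have [e <-] := gs v; rewrite wP /= diff_diff.
have [e|k2 k2P] := @factor_inj _ _ _ _ k (k1 \- (w' \o g)) ki.
  by apply/kd; rewrite /= linearB /d_from w'P wP /= subrr.
exists k2 => a; apply: ki; rewrite k2P /= k1P.
have -> : g (f a) = 0 by apply/fg; exists a.
by rewrite linear0 subr0.
Qed.

End ModuleComplexes.

Arguments diff_irr {R X i j} e e'.

(** * Cycles, boundaries and homology as modules *)

Lemma dep_choice (A : Type) (T : A -> Type) (P : forall x, T x -> Prop) :
  (forall x, exists y, P x y) -> exists f : forall x, T x, forall x, P x (f x).
Proof. by move=> ex; exists (fun x => projT1 (cid (ex x))) => x; case: cid. Qed.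

Section InducedMaps.
Variables (R : pzRingType) (A B : lmodType R).

Section Corestriction.
Variables (f : {linear A -> B}) (S : submodule B) (fS : forall x, f x \in S).

Definition corestrict (x : A) : subm S := exist _ (f x) (fS x).

Lemma corestrict_is_linear : linear corestrict.
Proof. by move=> a x y; apply: val_inj; rewrite /= linearP. Qed.

HB.instance Definition _ :=
  GRing.isLinear.Build R A (subm S) _ corestrict corestrict_is_linear.

End Corestriction.

Section Descent.
Variables (f : {linear A -> B}) (S : submodule A).
Variable f0 : forall x, x \in S -> f x = 0.

#[using="f0"]
Definition descend (u : quom S) : B := f (repr u).

Lemma descend_pi x : descend (quom_pi S x) = f x.
Proof.
apply/eqP; rewrite -subr_eq0 /descend -linearB; apply/eqP/f0.
exact: quom_repr.
Qed.

Lemma descend_is_linear : linear descend.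
Proof.
move=> a u v; have [x <-] := quom_pi_surj u; have [y <-] := quom_pi_surj v.
by rewrite -linearP !descend_pi linearP.
Qed.

HB.instance Definition _ :=
  GRing.isLinear.Build R (quom S) B _ descend descend_is_linear.

End Descent.
End InducedMaps.

Arguments corestrict {R A B} f {S} fS x.
Arguments descend {R A B} f {S} f0 u.

Section CyclesAndBoundaries.
Variables (R : pzRingType) (X : complex R).

Lemma ZsubP i j (e : i = j + 1) x : x \in Zsub X i <-> diff X e x = 0.
Proof.
have jE := eq_pred e; subst j; rewrite kerP /d_from.
by rewrite (diff_irr (esym _) e).
Qed.

Lemma BsubP i j (e : i = j + 1) y : y \in Bsub X j <-> exists x, diff X e x = y.
Proof. by subst i; rewrite imP. Qed.

Lemma diff_B i j (e : i = j + 1) x : diff X e x \in Bsub X j.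
Proof. by apply/(BsubP e); exists x. Qed.

Lemma sub_BZ n x : x \in Bsub X n -> x \in Zsub X n.
Proof.
move=> /(BsubP erefl)[y <-].
by apply/(ZsubP (esym (subrK 1 n))); rewrite diff_diff.
Qed.

Definition X_to_B i j (e : i = j + 1) : {linear X i -> Bt X j} :=
  corestrict (diff X e) (diff_B e).

Definition B_to_Z n : {linear Bt X n -> Zt X n} :=
  corestrict (subm_val (S := Bsub X n)) (fun x => sub_BZ (valP x)).

Definition Z_to_H n : {linear Zt X n -> Ht X n} :=
  quom_pi (restrict (Bsub X n) (Zsub X n)).

Definition Z_to_X n : {linear Zt X n -> X n} := subm_val (S := Zsub X n).

Definition B_to_X n : {linear Bt X n -> X n} := subm_val (S := Bsub X n).

Definition X_to_XB n : {linear X n -> XBt X n} := quom_pi (Bsub X n).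

Lemma Z_to_H_surj n : surj (Z_to_H n).
Proof. exact: quom_pi_surj. Qed.

Lemma X_to_XB_surj n : surj (X_to_XB n).
Proof. exact: quom_pi_surj. Qed.

Lemma Z_to_H_eq0 n z : Z_to_H n z = 0 <-> Z_to_X n z \in Bsub X n.
Proof. by rewrite quom_pi_eq0 inE. Qed.

Lemma X_to_B_val i j (e : i = j + 1) x : B_to_X j (X_to_B e x) = diff X e x.
Proof. by []. Qed.

Lemma X_to_B_eq0 i j (e : i = j + 1) x : X_to_B e x = 0 <-> x \in Zsub X i.
Proof.
rewrite (ZsubP e) -X_to_B_val; split=> [->|/inj0]; first exact: linear0.
by apply; apply: subm_val_inj.
Qed.

Lemma H_to_XB_ker n z :
  z \in restrict (Bsub X n) (Zsub X n) -> (X_to_XB n \o Z_to_X n) z = 0.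
Proof. by rewrite inE => zB; apply/quom_pi_eq0. Qed.

Definition H_to_XB n : {linear Ht X n -> XBt X n} :=
  descend (X_to_XB n \o Z_to_X n) (@H_to_XB_ker n).

Lemma X_to_B_ker i j (e : i = j + 1) x : x \in Bsub X i -> X_to_B e x = 0.
Proof. by move=> xB; apply/X_to_B_eq0/sub_BZ. Qed.

Definition XB_to_B i j (e : i = j + 1) : {linear XBt X i -> Bt X j} :=
  descend (X_to_B e) (X_to_B_ker e).

Lemma X_to_B_surj i j (e : i = j + 1) : surj (X_to_B e).
Proof.
move=> b; have /(BsubP e)[x xb] := valP b.
by exists x; apply: val_inj.
Qed.

Lemma Z_to_XP n x : x \in Zsub X n <-> exists z, Z_to_X n z = x.
Proof. exact: subm_valP. Qed.

Lemma B_to_XP n x : x \in Bsub X n <-> exists z, B_to_X n z = x.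
Proof. exact: subm_valP. Qed.

Lemma diff_Z i j (e : i = j + 1) z : diff X e (Z_to_X i z) = 0.
Proof. by apply/ZsubP/Z_to_XP; exists z. Qed.

Lemma short_exact_BZH n : short_exact (B_to_Z n) (Z_to_H n).
Proof.
split=> [b b' /(congr1 (Z_to_X n))|z|]; last exact: quom_pi_surj.
  by move=> h; apply: val_inj.
rewrite Z_to_H_eq0 B_to_XP; split=> [[b bz]|[b <-]]; exists b => //.
exact: val_inj.
Qed.

Lemma short_exact_ZXB i j (e : i = j + 1) : short_exact (Z_to_X i) (X_to_B e).
Proof.
split; [exact: subm_val_inj | | exact: X_to_B_surj].
by move=> x; rewrite X_to_B_eq0 Z_to_XP.
Qed.

Lemma short_exact_BXXB n : short_exact (B_to_X n) (X_to_XB n).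
Proof.
split; [exact: subm_val_inj | | exact: quom_pi_surj].
by move=> x; rewrite quom_pi_eq0 B_to_XP.
Qed.

Lemma H_to_XBE n z : H_to_XB n (Z_to_H n z) = X_to_XB n (Z_to_X n z).
Proof. exact: descend_pi. Qed.

Lemma XB_to_BE i j (e : i = j + 1) x : XB_to_B e (X_to_XB i x) = X_to_B e x.
Proof. exact: descend_pi. Qed.

Lemma short_exact_HXBB i j (e : i = j + 1) :
  short_exact (H_to_XB i) (XB_to_B e).
Proof.
split.
- apply: linear_inj => h; have [z <-] := Z_to_H_surj h.
  by rewrite H_to_XBE => /quom_pi_eq0 ?; apply/Z_to_H_eq0.
- move=> u; have [x <-] := X_to_XB_surj u; rewrite XB_to_BE.
  rewrite X_to_B_eq0; split=> [/Z_to_XP[z <-]|[h]].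
    by exists (Z_to_H i z); apply: H_to_XBE.
  have [z <-] := Z_to_H_surj h; rewrite H_to_XBE => /esym/quom_eq xz.
  rewrite -(subrK (Z_to_X i z) x) rpredD ?(valP z) //.
  exact: sub_BZ.
- by move=> b; have [x <-] := X_to_B_surj e b; exists (X_to_XB i x); apply: XB_to_BE.
Qed.

Section Orthogonality.
Variable V : lmodType R.

Section Ext.
Hypothesis extB : forall n, ext1_vanishes (Bt X n) V.
Hypothesis extH : forall n, ext1_vanishes (Ht X n) V.

Lemma ext1_X n : ext1_vanishes (X n) V.
Proof.
have extZ := ext1_vanishes_ext (short_exact_BZH n) (@extB n) (@extH n).
exact: ext1_vanishes_ext (short_exact_ZXB (esym (subrK 1 n))) extZ (@extB _).
Qed.

Lemma ext1_XB n : ext1_vanishes (XBt X n) V.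
Proof.
exact: ext1_vanishes_ext (short_exact_HXBB (esym (subrK 1 n))) (@extH n) (@extB _).
Qed.
End Ext.

Section Lift.
Hypothesis liftB : forall n, lifts V (Bt X n).
Hypothesis liftH : forall n, lifts V (Ht X n).

Lemma lifts_Z n : lifts V (Zt X n).
Proof. exact: lifts_ext (short_exact_BZH n) (@liftB n) (@liftH n). Qed.

Lemma lifts_X n : lifts V (X n).
Proof.
exact: lifts_ext (short_exact_ZXB (esym (subrK 1 n))) (@lifts_Z n) (@liftB _).
Qed.
End Lift.
End Orthogonality.
End CyclesAndBoundaries.

(** * Sums of disks and spheres *)

Section Standard.
Variable R : pzRingType.

Definition transport (S : int -> lmodType R) i j (e : i = j) :
    {linear S i -> S j} :=
  match e in _ = k return {linear S i -> S k} with erefl => idfun end.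

Lemma transport_id S i (e : i = i) x : transport S e x = x.
Proof. by rewrite (eq_irrelevance e erefl). Qed.

Lemma transportK S i j (e : i = j) (e' : j = i) :
  cancel (transport S e) (transport S e').
Proof. by subst j => x; rewrite !transport_id. Qed.

Variables S Q : int -> lmodType R.

(** The disks are indexed so that the differential out of degree n + 1 is the
    identity of S (n + 1) without any transport. *)
Definition std_term n : lmodType R := (S (n + 1) * Q n * S n)%type.

Definition std_diff_fun i j (e : i = j + 1) (v : std_term i) : std_term j :=
  (transport S e v.2, 0, 0).

Lemma std_diff_is_linear i j (e : i = j + 1) : linear (std_diff_fun e).
Proof.
move=> a u v; rewrite /std_diff_fun /= linearP.
by congr (_, _, _); rewrite /= scaler0 addr0.
Qed.

HB.instance Definition _ i j (e : i = j + 1) :=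
  GRing.isLinear.Build R (std_term i) (std_term j) _ (std_diff_fun e)
    (std_diff_is_linear e).

Lemma std_diff_diff i j k (eij : i = j + 1) (ejk : j = k + 1) x :
  std_diff_fun ejk (std_diff_fun eij x) = 0.
Proof. by rewrite /std_diff_fun /= linear0. Qed.

Definition std : complex R :=
  @Complex R std_term (fun i j e => std_diff_fun e) std_diff_diff.

Definition std1_fun n (s : S (n + 1)) : std n := (s, 0, 0).
Definition std2_fun n (q : Q n) : std n := (0, q, 0).
Definition std3_fun n (s : S n) : std n := (0, 0, s).

Lemma std1_is_linear n : linear (@std1_fun n).
Proof. by move=> a x y; congr (_, _, _); rewrite /= scaler0 addr0. Qed.
Lemma std2_is_linear n : linear (@std2_fun n).
Proof. by move=> a x y; congr (_, _, _); rewrite /= scaler0 addr0. Qed.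
Lemma std3_is_linear n : linear (@std3_fun n).
Proof. by move=> a x y; congr (_, _, _); rewrite /= scaler0 addr0. Qed.

HB.instance Definition _ n :=
  GRing.isLinear.Build R (S (n + 1)) (std n) _ (@std1_fun n) (@std1_is_linear n).
HB.instance Definition _ n :=
  GRing.isLinear.Build R (Q n) (std n) _ (@std2_fun n) (@std2_is_linear n).
HB.instance Definition _ n :=
  GRing.isLinear.Build R (S n) (std n) _ (@std3_fun n) (@std3_is_linear n).

Definition std1 n : {linear S (n + 1) -> std n} := @std1_fun n.
Definition std2 n : {linear Q n -> std n} := @std2_fun n.
Definition std3 n : {linear S n -> std n} := @std3_fun n.

Definition pr1 n : {linear std n -> S (n + 1)} := fst \o fst.
Definition pr2 n : {linear std n -> Q n} := snd \o fst.
Definition pr3 n : {linear std n -> S n} := snd.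

Lemma stdE n (v : std n) :
  v = std1 n (pr1 n v) + std2 n (pr2 n v) + std3 n (pr3 n v).
Proof.
case: v => [[s q] s']; rewrite /std1 /std2 /std3 /std1_fun /std2_fun /std3_fun /=.
by congr (_, _, _); rewrite /= ?add0r ?addr0.
Qed.

Lemma pr_std n a b c : let v := std1 n a + std2 n b + std3 n c in
  [/\ pr1 n v = a, pr2 n v = b & pr3 n v = c].
Proof. by split; rewrite /= /pr1 /pr2 /pr3 /= ?addr0 ?add0r. Qed.

Lemma std_diffE i j (e : i = j + 1) v :
  diff std e v = std1 j (transport S e (pr3 i v)).
Proof. by []. Qed.

Lemma std_d_to n v : diff std (erefl (n + 1)) v = std1 n (pr3 (n + 1) v).
Proof. by []. Qed.

Lemma std_ZP n v : v \in Zsub std n <-> pr3 n v = 0.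
Proof.
rewrite (ZsubP (esym (subrK 1 n))) std_diffE; split=> [|->]; last by rewrite !linear0.
by move=> /(congr1 (pr1 _)) h; apply: (can_inj (transportK (esym (subrK 1 n)) (subrK 1 n))); rewrite linear0.
Qed.

Lemma std_BP n v : v \in Bsub std n <-> pr2 n v = 0 /\ pr3 n v = 0.
Proof.
rewrite (BsubP erefl); split=> [[w <-]|[v2 v3]]; first by rewrite std_d_to.
exists (std3 (n + 1) (pr1 n v)); rewrite std_d_to [RHS]stdE v2 v3 !linear0.
by rewrite !addr0.
Qed.

(** The third component is forced by the first one: being a chain map means that
    it is the composite of the differential of X with the first component in
    the degree below. *)
Lemma chain_map_to_std (X : complex R) (al : forall n, {linear X n -> S (n + 1)})
    (be : forall n, {linear X n -> Q n}) :
    (forall n x, x \in Bsub X n -> be n x = 0) ->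
  exists f : chain_map X std,
    forall n x, pr1 n (f n x) = al n x /\ pr2 n (f n x) = be n x.
Proof.
move=> beB.
pose ga n : {linear X n -> S n} :=
  transport S (subrK 1 n) \o al (n - 1) \o d_from X n.
have /dep_choice[f fP] n : exists f : {linear X n -> std n},
    forall x, f x = std1 n (al n x) + std2 n (be n x) + std3 n (ga n x).
  by exists ((std1 n \o al n) \+ (std2 n \o be n) \+ (std3 n \o ga n)).
have fd i j (e : i = j + 1) x : f j (diff X e x) = diff std e (f i x).
  have jE := eq_pred e; subst j; rewrite !fP std_diffE.
  rewrite beB ?diff_B // (_ : ga _ _ = 0); last first.
    by rewrite /ga /= /d_from diff_diff !linear0.
  rewrite !linear0 !addr0; congr std1_fun.
  have [_ _ ->] := pr_std (al _ x) (be _ x) (ga _ x).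
  by rewrite /ga /= transportK /d_from (diff_irr (esym _) e).
exists (ChainMap fd) => n x; have := pr_std (al n x) (be n x) (ga n x).
by rewrite -fP => -[].
Qed.

Lemma to_std_pr3 (X : complex R) (f : chain_map X std) i j (e : i = j + 1) x :
  pr1 j (f j (diff X e x)) = transport S e (pr3 i (f i x)).
Proof. by rewrite cmap_diff. Qed.

Lemma to_std_B (X : complex R) (f : chain_map X std) n x :
  x \in Bsub X n -> pr2 n (f n x) = 0.
Proof. by move=> /(cmap_B f)/std_BP[]. Qed.

(** The first component determines the third one, by [to_std_pr3]. *)
Lemma to_std_ext (X : complex R) (f g : chain_map X std) :
    (forall n x, pr1 n (f n x) = pr1 n (g n x)) ->
    (forall n x, pr2 n (f n x) = pr2 n (g n x)) ->
  forall n x, f n x = g n x.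
Proof.
move=> e1 e2 n x; rewrite [LHS]stdE [RHS]stdE e1 e2; congr (_ + std3 n _).
apply: (can_inj (transportK (esym (subrK 1 n)) (subrK 1 n))).
by rewrite -!to_std_pr3.
Qed.

Lemma chain_map_from_std (X : complex R) (t : forall n, {linear S n -> X n})
    (u : forall n, {linear Q n -> Zt X n}) :
  exists f : chain_map std X, forall n,
  [/\ forall s, f n (std1 n s) = d_to X n (t (n + 1) s),
      forall q, f n (std2 n q) = Z_to_X X n (u n q)
    & forall s, f n (std3 n s) = t n s].
Proof.
pose fl n : {linear std n -> X n} :=
 ((d_to X n \o t (n + 1) \o pr1 n) \+ (Z_to_X X n \o u n \o pr2 n)) \+ (t n \o pr3 n).
have fd i j (e : i = j + 1) v : fl j (diff std e v) = diff X e (fl i v).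
  subst i; rewrite /fl std_d_to /= !linear0 !addr0 !linearD /= /d_to diff_diff.
  by rewrite add0r diff_Z add0r.
exists (ChainMap fd) => n; split=> z; rewrite /= !linear0 ?addr0 ?add0r //.
Qed.

End Standard.

Arguments std1 {R S Q} n.
Arguments std2 {R S Q} n.
Arguments std3 {R S Q} n.
Arguments pr1 {R S Q} n.
Arguments pr2 {R S Q} n.
Arguments pr3 {R S Q} n.

(** * Sums of disks and spheres over a class of modules *)

Section StandardClass.
Variables (R : pzRingType) (W : lmodType R -> Prop).
Hypothesis hext : closed_extensions W.
Hypothesis hsum : closed_finite_direct_sums W.

Lemma class_iso (A B : lmodType R) (f : {linear A -> B}) :
  injective f -> surj f -> W A -> W B.
Proof.
move=> fi fs WA; apply: (hsum (I := 'I_1) (in_ := fun=> f)) => // b.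
have [a ab] := fs b; exists (fun=> a); split; first by rewrite big_ord1.
move=> m; rewrite big_ord1 -ab => /fi am.
by apply: functional_extensionality_dep => i; rewrite (ord1 i).
Qed.

Lemma class_short_exact (A B C : lmodType R) (f : {linear A -> B})
  (g : {linear B -> C}) : short_exact f g -> W A -> W C -> W B.
Proof. by case=> fi fg gs; apply: hext fi fg gs. Qed.

Lemma class_prod (A B : lmodType R) : W A -> W B -> W (A * B)%type.
Proof.
have [|i iE] := @linear_of_fun R A (A * B)%type (fun a => (a, 0)).
  by move=> a x y; congr (_, _); rewrite /= scaler0 addr0.
apply: (@class_short_exact _ _ _ i snd); split.
- by move=> x y; rewrite !iE => -[].
- move=> [a b]; split=> [/= ->|[x]]; first by exists a.
  by rewrite iE => -[].
- by move=> b; exists (0, b).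
Qed.

Variables S Q : int -> lmodType R.
Hypotheses (WS : forall n, W (S n)) (WQ : forall n, W (Q n)).

Lemma std1_B n s : std1 n s \in Bsub (std S Q) n.
Proof. by apply/std_BP. Qed.

Lemma std2_Z n q : std2 n q \in Zsub (std S Q) n.
Proof. by apply/std_ZP. Qed.

Lemma std_CE_class : CE_class W (std S Q).
Proof.
move=> n.
pose b := corestrict (std1 n) (@std1_B n).
pose z := corestrict (std1 n) (fun s => sub_BZ (@std1_B n s)).
pose h := corestrict (std2 n) (@std2_Z n).
have stdZ (v : Zt (std S Q) n) :
  Z_to_X _ n v = std1 n (pr1 n (Z_to_X _ n v)) + std2 n (pr2 n (Z_to_X _ n v)).
  have /std_ZP v3 : Z_to_X _ n v \in Zsub (std S Q) n by apply/Z_to_XP; exists v.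
  by rewrite [LHS]stdE v3 linear0 addr0.
split.
- apply: class_prod => //; exact: class_prod.
- apply: (@class_short_exact _ _ _ z (pr2 n \o Z_to_X _ n)) => //; split.
  + by move=> s s' /(congr1 (pr1 n \o Z_to_X _ n)).
  + move=> v; split=> [v20|[s <-]] //; exists (pr1 n (Z_to_X _ n v)).
    have v2 : pr2 n (Z_to_X _ n v) = 0 by [].
    by apply: subm_val_inj; rewrite [RHS]stdZ v2 linear0 addr0.
  + by move=> q; exists (h q).
- apply: (@class_iso _ _ b) => // [s s' /(congr1 (pr1 n \o B_to_X _ n)) //|v].
  exists (pr1 n (B_to_X _ n v)); apply: subm_val_inj.
  have /std_BP[v2 v3] : B_to_X _ n v \in Bsub (std S Q) n by apply/B_to_XP; exists v.
  by rewrite [RHS]stdE v2 v3 !linear0 !addr0.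
- apply: (@class_iso _ _ (Z_to_H _ n \o h)) => //.
    apply: linear_inj => q hq0.
    by have /Z_to_H_eq0/std_BP[] : Z_to_H _ n (h q) = 0 by [].
  move=> u; have [v <-] := Z_to_H_surj u; exists (pr2 n (Z_to_X _ n v)).
  apply/eqP; rewrite -subr_eq0 -(linearB (Z_to_H _ n)); apply/eqP/Z_to_H_eq0.
  rewrite linearB [X in _ - X]stdZ opprD addrCA subrr addr0.
  by rewrite rpredN std1_B.
Qed.

End StandardClass.

Arguments std1_B {R S Q n} s.
Arguments std2_Z {R S Q n} q.

(** * C-E short exact sequences and splicing *)

Section InducedMapsOnGenerators.
Variable R : pzRingType.

Definition X_to_XZ (X : complex R) n : {linear X n -> XZt X n} :=
  quom_pi (Zsub X n).

Lemma X_to_XZ_surj (X : complex R) n : surj (X_to_XZ X n).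
Proof. exact: quom_pi_surj. Qed.

Variables (X Y : complex R) (f : chain_map X Y) (n : int).

Lemma XZmap_pi x : XZmap f n (X_to_XZ X n x) = X_to_XZ Y n (f n x).
Proof. exact: quom_map_pi. Qed.

Lemma XBmap_pi x : XBmap f n (X_to_XB X n x) = X_to_XB Y n (f n x).
Proof. exact: quom_map_pi. Qed.

Lemma Hmap_pi z : Hmap f n (Z_to_H X n z) = Z_to_H Y n (Zmap f n z).
Proof. exact: quom_map_pi. Qed.

End InducedMapsOnGenerators.

Section CEShortExact.
Variable R : pzRingType.

(** Surjectivity on cycles means that the connecting map on homology vanishes.
    It makes the induced sequences of cycles, boundaries, homology and both
    quotients short exact, by the chases below. *)
Definition CE_short_exact (K V L : complex R) (phi : chain_map K V)
    (pi : chain_map V L) : Prop :=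
  (forall n, short_exact (phi n) (pi n)) /\
  (forall n l, l \in Zsub L n -> exists2 v, v \in Zsub V n & pi n v = l).

Section Consequences.
Variables (K V L : complex R) (phi : chain_map K V) (pi : chain_map V L).
Hypothesis ses : CE_short_exact phi pi.
Variable n : int.

Lemma CE_ses_comp k : pi n (phi n k) = 0.
Proof. by have [_ ex _] := ses.1 n; apply/ex; exists k. Qed.

Lemma CE_ses_ker v w : pi n v = pi n w -> exists k, v = phi n k + w.
Proof.
move=> vw; have [_ ex _] := ses.1 n.
have /ex[k kE] : pi n (v - w) = 0 by rewrite linearB vw subrr.
by exists k; rewrite kE subrK.
Qed.

Lemma CE_ses_Z k : phi n k \in Zsub V n -> k \in Zsub K n.
Proof.
have e : n = n - 1 + 1 by rewrite subrK.
rewrite !(ZsubP e) -cmap_diff => dk; have [inj _ _] := ses.1 (n - 1).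
exact: inj0 inj dk.
Qed.

Lemma CE_ses_Z_ker v : v \in Zsub V n -> pi n v = 0 ->
  exists2 k, k \in Zsub K n & phi n k = v.
Proof.
move=> vZ; have [_ ex _] := ses.1 n => /ex[k kv]; exists k => //.
by apply: CE_ses_Z; rewrite kv.
Qed.

Lemma CE_ses_pre_Z v : pi n v \in Zsub L n ->
  exists k, exists2 z, z \in Zsub V n & v = phi n k + z.
Proof.
move=> /ses.2[z zZ /esym/CE_ses_ker[k kE]]; by exists k, z.
Qed.
End Consequences.

Section Boundaries.
Variables (K V L : complex R) (phi : chain_map K V) (pi : chain_map V L).
Hypothesis ses : CE_short_exact phi pi.
Variable n : int.

(** If v = d w, then the image of w in L is a cycle, so w can be corrected by a
    cycle of V to come from K. *)
Lemma CE_ses_B_ker v : v \in Bsub V n -> pi n v = 0 ->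
  exists2 k, k \in Bsub K n & phi n k = v.
Proof.
move=> /(BsubP erefl)[w <-]; rewrite cmap_diff => dw.
have [|k [z zZ wE]] := @CE_ses_pre_Z _ _ _ _ _ ses (n + 1) w.
  apply/(ZsubP erefl); exact: dw.
exists (diff K erefl k); first exact: diff_B.
by rewrite wE linearD ((ZsubP erefl z).1 zZ) addr0 cmap_diff.
Qed.

Lemma CE_ses_B k : phi n k \in Bsub V n -> k \in Bsub K n.
Proof.
move=> /CE_ses_B_ker; rewrite (CE_ses_comp ses) => -[] // k' k'B kk'.
by have [inj _ _] := ses.1 n; rewrite -(inj _ _ kk').
Qed.

Lemma CE_ses_pre_B v : pi n v \in Bsub L n ->
  exists k, exists2 b, b \in Bsub V n & v = phi n k + b.
Proof.
move=> /(BsubP erefl)[l dl]; have [_ _ sur] := ses.1 (n + 1).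
have [w wl] := sur l; have [|k kE] := @CE_ses_ker _ _ _ _ _ ses n v (diff V erefl w).
  by rewrite cmap_diff wl.
by exists k, (diff V erefl w) => //; apply: diff_B.
Qed.

End Boundaries.

Section Splice.
Variables (V1 K V2 L V3 : complex R).
Variables (pi1 : chain_map V1 K) (phi2 : chain_map K V2)
          (pi2 : chain_map V2 L) (phi3 : chain_map L V3).
Variables (K1 L3 : complex R) (phi1 : chain_map K1 V1) (pi3 : chain_map V3 L3).
Hypotheses (ses1 : CE_short_exact phi1 pi1) (ses2 : CE_short_exact phi2 pi2)
           (ses3 : CE_short_exact phi3 pi3).
Variables (a : chain_map V1 V2) (b : chain_map V2 V3).
Hypotheses (aE : forall n x, a n x = phi2 n (pi1 n x))
           (bE : forall n x, b n x = phi3 n (pi2 n x)).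
Variable n : int.

Lemma splice_comp x : b n (a n x) = 0.
Proof. by rewrite bE aE (CE_ses_comp ses2) linear0. Qed.

Lemma splice_b0 y : b n y = 0 -> pi2 n y = 0.
Proof. by rewrite bE; have [inj _ _] := ses3.1 n; apply: inj0. Qed.

Lemma splice_surj k : exists x, pi1 n x = k.
Proof. by have [_ _ sur] := ses1.1 n. Qed.

Lemma splice_exact : exact (a n) (b n).
Proof.
move=> y; split=> [/splice_b0|[x <-]]; last exact: splice_comp.
have [_ ex _] := ses2.1 n => /ex[k <-].
by have [x <-] := splice_surj k; exists x; rewrite aE.
Qed.

Lemma splice_exact_Z : exact (Zmap a n) (Zmap b n).
Proof.
move=> y; split=> [/(congr1 (Z_to_X _ n)) by0|[x <-]]; last first.
  by apply: subm_val_inj; apply: splice_comp.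
have /(CE_ses_Z_ker ses2)[|k kZ ky] : Z_to_X _ n y \in Zsub V2 n.
- by apply/Z_to_XP; exists y.
- exact: splice_b0.
have [x /Z_to_XP[z <-] xk] := ses1.2 _ _ kZ.
by exists z; apply: subm_val_inj; rewrite -[RHS]ky -xk; apply: aE.
Qed.

Lemma splice_exact_B : exact (Bmap a n) (Bmap b n).
Proof.
move=> y; split=> [/(congr1 (B_to_X _ n)) by0|[x <-]]; last first.
  by apply: subm_val_inj; apply: splice_comp.
have /(CE_ses_B_ker ses2)[|k kB ky] : B_to_X _ n y \in Bsub V2 n.
- by apply/B_to_XP; exists y.
- exact: splice_b0.
have /(BsubP erefl)[k' k'k] := kB.
have [_ _ sur] := ses1.1 (n + 1); have [x xk'] := sur k'.
exists (X_to_B _ erefl x); apply: subm_val_inj; rewrite -[RHS]ky -k'k -xk'.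
by rewrite -cmap_diff; apply: aE.
Qed.

Lemma splice_exact_XZ : exact (XZmap a n) (XZmap b n).
Proof.
move=> u; have [y <-] := X_to_XZ_surj u; split=> [|[w <-]]; last first.
  have [x <-] := X_to_XZ_surj w.
  by rewrite !XZmap_pi splice_comp linear0.
rewrite XZmap_pi => /quom_pi_eq0; rewrite bE.
move=> /(CE_ses_Z ses3)/(CE_ses_pre_Z ses2)[k [z zZ ->]].
have [x <-] := splice_surj k; exists (X_to_XZ _ n x).
rewrite XZmap_pi; apply/quom_eq.
by rewrite aE opprD addrA subrr sub0r rpredN.
Qed.

Lemma splice_exact_XB : exact (XBmap a n) (XBmap b n).
Proof.
move=> u; have [y <-] := X_to_XB_surj u; split=> [|[w <-]]; last first.
  have [x <-] := X_to_XB_surj w.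
  by rewrite !XBmap_pi splice_comp linear0.
rewrite XBmap_pi => /quom_pi_eq0; rewrite bE.
move=> /(CE_ses_B ses3)/(CE_ses_pre_B ses2)[k [z zB ->]].
have [x <-] := splice_surj k; exists (X_to_XB _ n x).
rewrite XBmap_pi; apply/quom_eq.
by rewrite aE opprD addrA subrr sub0r rpredN.
Qed.

Lemma splice_exact_H : exact (Hmap a n) (Hmap b n).
Proof.
move=> u; have [y <-] := Z_to_H_surj u; split=> [|[w <-]]; last first.
  have [x <-] := Z_to_H_surj w.
  rewrite !Hmap_pi.
  have -> : Zmap b n (Zmap a n x) = 0 by apply/splice_exact_Z; exists x.
  exact: linear0.
rewrite Hmap_pi => /Z_to_H_eq0; rewrite [Z_to_X _ _ _]bE.
move=> /(CE_ses_B ses3)/(CE_ses_pre_B ses2)[k [z zB yE]].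
have kZ : k \in Zsub K n.
  apply: (CE_ses_Z ses2); rewrite -(addrK z (phi2 n k)) -yE rpredB //.
    by apply/Z_to_XP; exists y.
  exact: sub_BZ.
have [_ /Z_to_XP[x <-] xk] := ses1.2 _ _ kZ; exists (Z_to_H _ n x).
rewrite Hmap_pi; apply/quom_eq; rewrite inE.
have -> : val (Zmap a n x - y) = a n (Z_to_X _ n x) - Z_to_X _ n y.
  exact: (linearB (Z_to_X _ n)).
by rewrite aE xk [Z_to_X _ _ y]yE opprD addrA subrr sub0r rpredN.
Qed.

End Splice.
End CEShortExact.

(** * Covers by sums of disks and spheres *)

Section KernelCokernelComplexes.
Variable R : pzRingType.

Lemma kernel_complex (V L : complex R) (pi : chain_map V L) :
  exists (K : complex R) (phi : chain_map K V),
    forall n, injective (phi n) /\ exact (phi n) (pi n).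
Proof.
have dK i j (e : i = j + 1) x : x \in ker (pi i) -> diff V e x \in ker (pi j).
  by move=> /kerP px; apply/kerP; rewrite cmap_diff px linear0.
pose d i j (e : i = j + 1) : {linear subm (ker (pi i)) -> subm (ker (pi j))} :=
  subm_map (diff V e) (dK i j e).
have dd i j k (eij : i = j + 1) (ejk : j = k + 1) x : d j k ejk (d i j eij x) = 0.
  by apply: subm_val_inj; apply: diff_diff.
pose K := @Complex R (fun n => subm (ker (pi n))) d dd.
exists K, (@ChainMap R K V (fun n => subm_val (S := ker (pi n))) (fun i j e x => erefl)).
move=> n; split; first exact: subm_val_inj.
by move=> x; rewrite -subm_valP kerP.
Qed.

Lemma cokernel_complex (K V : complex R) (phi : chain_map K V) :
  exists (L : complex R) (pi : chain_map V L),
    forall n, exact (phi n) (pi n) /\ surj (pi n).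
Proof.
have dL i j (e : i = j + 1) x : x \in im (phi i) -> diff V e x \in im (phi j).
  by move=> /imP[k <-]; apply/imP; exists (diff K e k); rewrite cmap_diff.
pose d i j (e : i = j + 1) : {linear quom (im (phi i)) -> quom (im (phi j))} :=
  quom_map (diff V e) (dL i j e).
have [q [qs qP dE]] : exists q : forall n, {linear V n -> quom (im (phi n))},
    [/\ forall n, surj (q n), forall n, exact (phi n) (q n)
      & forall i j e x, d i j e (q i x) = q j (diff V e x)].
  exists (fun n => quom_pi (im (phi n))); split=> [n|n x|i j e x].
  - exact: quom_pi_surj.
  - by rewrite quom_pi_eq0 imP.
  - exact: quom_map_pi.
have dd i j k (eij : i = j + 1) (ejk : j = k + 1) x : d j k ejk (d i j eij x) = 0.
  by have [v <-] := qs _ x; rewrite !dE diff_diff linear0.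
pose L := @Complex R (fun n => quom (im (phi n))) d dd.
have qd i j (e : i = j + 1) x : q j (diff V e x) = diff L e (q i x).
  exact/esym/dE.
by exists L, (@ChainMap R V L q qd).
Qed.

Definition comp_chain (X Y Z : complex R) (g : chain_map Y Z) (f : chain_map X Y) :
  chain_map X Z.
Proof.
exists (fun n => g n \o f n) => i j e x.
by rewrite /= !cmap_diff.
Defined.

Lemma comp_chainE (X Y Z : complex R) (g : chain_map Y Z) (f : chain_map X Y) n x :
  comp_chain g f n x = g n (f n x).
Proof. by []. Qed.

Lemma chain_inverse (X Y : complex R) (f : chain_map X Y) :
    (forall n, injective (f n)) -> (forall n, surj (f n)) ->
  exists g : chain_map Y X, forall n y, f n (g n y) = y.
Proof.
move=> fi fs.
have /dep_choice[g gP] n : exists g : {linear Y n -> X n}, forall y, f n (g y) = y.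
  by apply: (@factor_inj _ _ _ _ (f n) idfun (fi n)) => y; apply: fs.
have gd i j (e : i = j + 1) y : g j (diff Y e y) = diff X e (g i y).
  by apply: (fi j); rewrite gP cmap_diff gP.
by exists (ChainMap gd).
Qed.

End KernelCokernelComplexes.

Section Covers.
Variables (R : pzRingType) (L : complex R) (S Q : int -> lmodType R).

Variables (p : forall m, {linear S m -> Bt L (m - 1)})
          (r : forall n, {linear Q n -> Ht L n}).

(** Here f comes from lifts of p to maps S n -> L n and of r to maps
    Q n -> Z_n(L); these are not unique, and the statements below are in
    terms of p and r only. *)
Definition cover_of (f : chain_map (std S Q) L) : Prop := forall n,
  [/\ forall s, f n (std1 n s) = d_to L n (f (n + 1) (std3 (n + 1) s)),
      forall s, X_to_B L (eq_succ_pred n) (f n (std3 n s)) = p n s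
    & forall q, exists2 z, f n (std2 n q) = Z_to_X L n z & Z_to_H L n z = r n q].

Lemma cover_exists :
    (forall m, surj (p m)) -> (forall n, surj (r n)) ->
    (forall m, lifts (S m) (Zt L m)) -> (forall n, lifts (Q n) (Bt L n)) ->
  exists f, cover_of f.
Proof.
move=> ps rs liftS liftQ.
have /dep_choice[t tP] m : exists t : {linear S m -> L m},
    forall s, X_to_B L (eq_succ_pred m) (t s) = p m s.
  have [inj ex sur] := short_exact_ZXB L (eq_succ_pred m).
  by apply: (liftS m _ _ _ _ inj ex (p m)) => s; apply: sur.
have /dep_choice[u uP] n : exists u : {linear Q n -> Zt L n},
    forall q, Z_to_H L n (u q) = r n q.
  have [inj ex sur] := short_exact_BZH L n.
  by apply: (liftQ n _ _ _ _ inj ex (r n)) => q; apply: sur.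
have [f fP] := chain_map_from_std t u.
exists f => n; have [f1 f2 f3] := fP n; split.
- by move=> s; rewrite f1; have [_ _ ->] := fP (n + 1).
- by move=> s; rewrite f3.
- by move=> q; exists (u n q).
Qed.

Variable f : chain_map (std S Q) L.
Hypothesis fP : cover_of f.

Lemma cover_B0 n s : f n (std1 n s) = 0 <-> p (n + 1) s = 0.
Proof.
have [-> _ _] := fP n; have [_ <- _] := fP (n + 1).
by rewrite X_to_B_eq0 (ZsubP erefl).
Qed.

Section Surjective.
Hypotheses (ps : forall m, surj (p m)) (rs : forall n, surj (r n)).

Lemma cover_B n b : b \in Bsub L n -> exists s, f n (std1 n s) = b.
Proof.
move=> /(BsubP erefl)[y <-].
have [s sE] := ps (X_to_B L (eq_succ_pred (n + 1)) y); exists s.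
have [-> _ _] := fP n; have [_ sp _] := fP (n + 1).
apply/eqP; rewrite -subr_eq0 -linearB; apply/eqP/(ZsubP erefl).
by apply/(X_to_B_eq0 (eq_succ_pred (n + 1))); rewrite linearB sp sE subrr.
Qed.

Lemma cover_Z n z : z \in Zsub L n ->
  exists2 v, v \in Zsub (std S Q) n & f n v = z.
Proof.
move=> /Z_to_XP[c <-]; have [q qE] := rs (Z_to_H L n c).
have [_ _ /(_ q)[c' fq c'q]] := fP n.
have [|s sE] := @cover_B n (Z_to_X L n (c - c')).
  by apply/Z_to_H_eq0; rewrite linearB c'q qE subrr.
exists (std1 n s + std2 n q); first by apply/std_ZP; rewrite linearD addr0.
by rewrite linearD sE fq linearB subrK.
Qed.

Lemma cover_surj n : surj (f n).
Proof.
move=> x; have [s sE] := ps (X_to_B L (eq_succ_pred n) x).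
have [_ f3 _] := fP n.
have [|v _ vE] := @cover_Z n (x - f n (std3 n s)).
  by apply/(X_to_B_eq0 (eq_succ_pred n)); rewrite linearB f3 sE subrr.
by exists (v + std3 n s); rewrite linearD vE subrK.
Qed.
End Surjective.

Lemma cover_Z_pr3 n v : f n v \in Zsub L n -> p n (pr3 n v) = 0.
Proof.
have [_ <- _] := fP n => /(X_to_B_eq0 (eq_succ_pred n)) fv.
have vZ : std1 n (pr1 n v) + std2 n (pr2 n v) \in Zsub (std S Q) n.
  by apply/std_ZP; rewrite linearD addr0.
move: fv; rewrite {1}[v]stdE linearD linearD.
by rewrite (X_to_B_eq0 _ _).2 ?add0r // cmap_Z.
Qed.

Lemma cover_B_pr2 n v : v \in Zsub (std S Q) n -> f n v \in Bsub L n ->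
  r n (pr2 n v) = 0.
Proof.
move=> /std_ZP v3; have [_ _ /(_ (pr2 n v))[z fz <-]] := fP n.
rewrite [v]stdE v3 linear0 addr0 linearD rpredDl; last first.
  by apply: cmap_B; apply/std_BP.
by rewrite fz => /Z_to_H_eq0.
Qed.

(** With isomorphisms for p and r, the cover splits L into disks and spheres. *)
Lemma cover_inj : (forall m, injective (p m)) -> (forall n, injective (r n)) ->
  forall n, injective (f n).
Proof.
move=> pi ri n; apply: linear_inj => v fv.
have v3 : pr3 n v = 0.
  by apply: (inj0 (pi n)); apply: cover_Z_pr3; rewrite fv rpred0.
have v2 : pr2 n v = 0.
  by apply: (inj0 (ri n)); apply: cover_B_pr2; rewrite ?fv ?rpred0 //; apply/std_ZP.
have vE : v = std1 n (pr1 n v) by rewrite {1}[v]stdE v2 v3 !linear0 !addr0.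
rewrite vE; have -> : pr1 n v = 0; last exact: linear0.
by apply: (inj0 (pi (n + 1))); apply/cover_B0; rewrite -vE.
Qed.

End Covers.

(** * Lifting, extension and one-step resolutions *)

Section Resolutions.
Variables (R : pzRingType) (W : lmodType R -> Prop).
Hypothesis extWW : forall V V', W V -> W V' -> ext1_vanishes V V'.
Hypothesis hext : closed_extensions W.
Hypothesis hsum : closed_finite_direct_sums W.

(** The identities of the B_n and H_n lift along T_(n+1) -> B_n and Z_n -> H_n
    by self-orthogonality, so T is covered isomorphically by the disks on its
    boundaries and the spheres on its homology. *)
Lemma CE_class_retract (T : complex R) : CE_class W T ->
  exists S Q : int -> lmodType R,
  [/\ forall n, W (S n), forall n, W (Q n)
    & exists (psi : chain_map (std S Q) T) (theta : chain_map T (std S Q)),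
        forall n x, psi n (theta n x) = x].
Proof.
move=> WT; pose S m := Bt T (m - 1); pose Q := Ht T.
have WS n : W (S n) by have [] := WT (n - 1).
have WQ n : W (Q n) by have [] := WT n.
exists S, Q; split=> //.
pose p m : {linear S m -> Bt T (m - 1)} := idfun.
pose r n : {linear Q n -> Ht T n} := idfun.
have ps m : surj (p m) by move=> x; exists x.
have rs m : surj (r m) by move=> x; exists x.
have [|n|psi psiP] := cover_exists ps rs.
- by move=> m; apply/ext1_vanishes_lifts/extWW => //; have [] := WT m.
- by apply/ext1_vanishes_lifts/extWW => //; have [] := WT n.
have [|n|theta thetaP] := @chain_inverse _ _ _ psi.
- by apply: (cover_inj psiP) => k x y.
- exact: (cover_surj psiP ps rs).
by exists psi, theta.
Qed.

Section LiftExtend.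
Variables (K V L : complex R) (phi : chain_map K V) (pi : chain_map V L).
Hypothesis ses : CE_short_exact phi pi.

(** By [CE_class_retract] it suffices to lift maps out of disks and spheres,
    i.e. to lift linear maps along V_n -> L_n and along Z_n(V) -> Z_n(L). *)
Lemma CE_lift :
    (forall U, W U -> forall n, lifts U (K n) /\ lifts U (Zt K n)) ->
  forall (T : complex R), CE_class W T -> forall f : chain_map T L,
  exists g : chain_map T V, forall n x, pi n (g n x) = f n x.
Proof.
move=> liftK T /CE_class_retract[S [Q [WS WQ [psi [theta psiK]]]]] f.
pose h := comp_chain f psi.
have /dep_choice[t tP] n : exists t : {linear S n -> V n},
    forall s, pi n (t s) = h n (std3 n s).
  have [inj ex sur] := ses.1 n.
  by apply: ((liftK _ (WS n) n).1 _ _ _ _ inj ex (h n \o std3 n)) => s; apply: sur.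
have /dep_choice[u uP] n : exists u : {linear Q n -> Zt V n},
    forall q, pi n (Z_to_X _ n (u q)) = h n (std2 n q).
  have hZ q : h n (std2 n q) \in Zsub L n by apply/cmap_Z/std_ZP.
  have inj : injective (Zmap phi n).
    move=> x y /(congr1 (Z_to_X _ n)) xy; apply: subm_val_inj.
    by have [inj _ _] := ses.1 n; apply: inj.
  have ex : exact (Zmap phi n) (Zmap pi n).
    move=> y; split=> [/(congr1 (Z_to_X _ n)) y0|[k <-]]; last first.
      by apply: subm_val_inj; apply: CE_ses_comp ses _ _.
    have /(CE_ses_Z_ker ses)[|k /Z_to_XP[z <-] zy] : Z_to_X _ n y \in Zsub V n.
    - by apply/Z_to_XP; exists y.
    - exact: y0.
    by exists z; apply: subm_val_inj.
  have [|u uP] := (liftK _ (WQ n) n).2 _ _ _ _ inj ex (corestrict (h n \o std2 n) hZ).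
    move=> q; have [v /Z_to_XP[z <-] zq] := ses.2 _ _ (hZ q).
    by exists z; apply: subm_val_inj.
  by exists u => q; have /(congr1 (Z_to_X _ n)) := uP q.
have [g gP] := chain_map_from_std t u.
exists (comp_chain g theta) => n x; rewrite comp_chainE.
have -> : f n x = h n (theta n x) by rewrite comp_chainE psiK.
have [g1 g2 g3] := gP n; rewrite [theta n x]stdE !linearD g1 g2 g3 uP tP.
congr (_ + _ + _); rewrite /d_to cmap_diff tP -cmap_diff.
by rewrite std_d_to.
Qed.

(** By [CE_class_retract] it suffices to extend maps into disks and spheres,
    i.e. to extend linear maps along K_n -> V_n and along
    K_n / B_n -> V_n / B_n. *)
Lemma CE_extend :
    (forall U, W U -> forall n, ext1_vanishes (L n) U /\ ext1_vanishes (XBt L n) U) ->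
  forall (T : complex R), CE_class W T -> forall f : chain_map K T,
  exists g : chain_map V T, forall n x, g n (phi n x) = f n x.
Proof.
move=> extL T /CE_class_retract[S [Q [WS WQ [psi [theta psiK]]]]] f.
pose h := comp_chain theta f.
have /dep_choice[al alP] n : exists al : {linear V n -> S (n + 1)},
    forall k, al (phi n k) = pr1 n (h n k).
  have [inj ex sur] := ses.1 n.
  apply: ((extL _ (WS (n + 1)) n).1 _ _ _ _ ex sur (pr1 n \o h n)) => k /(inj0 inj) ->.
  exact: linear0.
have /dep_choice[be beP] n : exists be : {linear XBt V n -> Q n},
    forall k, be (X_to_XB V n (phi n k)) = pr2 n (h n k).
  have ex : exact (X_to_XB V n \o phi n) (XBmap pi n).
    move=> w; have [v <-] := X_to_XB_surj w; split=> [|[k <- /=]].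
      rewrite XBmap_pi => /quom_pi_eq0/(CE_ses_pre_B ses)[k [b bB ->]]; exists k.
      rewrite linearD (_ : X_to_XB V n b = 0) ?addr0 //; exact/quom_pi_eq0.
    rewrite XBmap_pi (CE_ses_comp ses); exact: linear0.
  have sur : surj (XBmap pi n).
    move=> w; have [l <-] := X_to_XB_surj w; have [_ _ sur] := ses.1 n.
    by have [v <-] := sur l; exists (X_to_XB V n v); apply: XBmap_pi.
  apply: ((extL _ (WQ n) n).2 _ _ _ _ ex sur (pr2 n \o h n)) => k.
  by move=> /quom_pi_eq0/(CE_ses_B ses)/to_std_B; apply.
have [|g gP] := chain_map_to_std al (be := fun n => be n \o X_to_XB V n).
  by move=> n v /quom_pi_eq0 vB; rewrite /= [X_to_XB _ _ _]vB linear0.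
exists (comp_chain psi g) => n x; rewrite comp_chainE.
have -> : f n x = psi n (h n x) by rewrite comp_chainE psiK.
congr (psi n _); apply: (@to_std_ext _ _ _ _ (comp_chain g phi) h) => {n x} n x.
  by rewrite comp_chainE; have [-> _] := gP n (phi n x).
by rewrite comp_chainE; have [_ ->] := gP n (phi n x); apply: beP.
Qed.

End LiftExtend.

(** The invariant of the iterated construction: unlike the condition on all
    terms and cycles, it passes directly to syzygies and cosyzygies. *)
Definition BH_Gorenstein (X : complex R) : Prop :=
  forall n, Gorenstein W (Bt X n) /\ Gorenstein W (Ht X n).

Lemma BH_ext1 X U : BH_Gorenstein X -> W U ->
  forall n, ext1_vanishes (X n) U /\ ext1_vanishes (XBt X n) U.
Proof.
move=> GX WU.
have eB n : ext1_vanishes (Bt X n) U by apply: Gorenstein_ext1 (GX n).1 WU.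
have eH n : ext1_vanishes (Ht X n) U by apply: Gorenstein_ext1 (GX n).2 WU.
by move=> n; split; [apply: ext1_X|apply: ext1_XB].
Qed.

Lemma BH_lifts X U : BH_Gorenstein X -> W U ->
  forall n, [/\ lifts U (X n), lifts U (Zt X n) & lifts U (Bt X n)].
Proof.
move=> GX WU.
have lB n : lifts U (Bt X n).
  by apply/ext1_vanishes_lifts/(ext1_Gorenstein extWW (GX n).1).
have lH n : lifts U (Ht X n).
  by apply/ext1_vanishes_lifts/(ext1_Gorenstein extWW (GX n).2).
by move=> n; split; [apply: lifts_X|apply: lifts_Z|].
Qed.

(** Cover the boundaries and homology of L by modules of W and assemble these
    covers into f.  The kernel K of f has B_n(K) = Ker (S (n + 1) -> B_n(L)) and
    H_n(K) = Ker (Q n -> H_n(L)), which are syzygies of Gorenstein modules. *)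
Lemma syzygy_step (L : complex R) : BH_Gorenstein L ->
  exists (K V : complex R) (phi : chain_map K V) (pi : chain_map V L),
  [/\ CE_class W V, CE_short_exact phi pi & BH_Gorenstein K].
Proof.
move=> GL.
have /dep_choice[S /dep_choice[p pP]] m := Gorenstein_syzygy (GL (m - 1)).1.
have /dep_choice[Q /dep_choice[r rP]] n := Gorenstein_syzygy (GL n).2.
have WS m : W (S m) by have [] := pP m.
have WQ m : W (Q m) by have [] := rP m.
have ps m : surj (p m) by have [] := pP m.
have rs m : surj (r m) by have [] := rP m.
have [|n|f fP] := cover_exists ps rs.
- by move=> m; have [] := BH_lifts GL (WS m) m.
- by have [] := BH_lifts GL (WQ n) n.
have fs := cover_surj fP ps rs; have fZ := cover_Z fP ps rs.
have [K [phi phiP]] := kernel_complex f.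
have ses : CE_short_exact phi f.
  by split=> n; [have [] := phiP n|apply: fZ].
exists K, (std S Q), phi, f; split=> //; first exact: std_CE_class.
have phiB n b : phi n (B_to_X K n b) = std1 n (pr1 n (phi n (B_to_X K n b))).
  have /std_BP[v2 v3] : phi n (B_to_X K n b) \in Bsub (std S Q) n.
    by apply: cmap_B; apply/B_to_XP; exists b.
  by rewrite [LHS]stdE v2 v3 !linear0 !addr0.
have kerB n s : p (n + 1) s = 0 <-> exists b, pr1 n (phi n (B_to_X K n b)) = s.
  rewrite -(cover_B0 fP); split=> [fs0|[b <-]]; last first.
    by rewrite -phiB (CE_ses_comp ses).
  have /(CE_ses_B_ker ses)[//|k /B_to_XP[b <-] bE] : std1 n s \in Bsub (std S Q) n.
    exact/std_BP.
  by exists b; rewrite bE.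
move=> n; split.
  have [_ _] := pP (n + 1).
  move=> /(_ _ (pr1 n \o phi n \o B_to_X K n)); apply=> [|s]; last exact: kerB.
  apply: linear_inj => b b0; apply: (inj0 (@subm_val_inj _ _ _)).
  have [inj _ _] := ses.1 n; apply: (inj0 inj); rewrite [LHS]phiB.
  by rewrite (_ : pr1 n _ = 0) ?linear0.
have phiZ z : pr3 n (phi n (Z_to_X K n z)) = 0.
  by apply/std_ZP/cmap_Z/Z_to_XP; exists z.
have zB z : z \in restrict (Bsub K n) (Zsub K n) ->
    (pr2 n \o phi n \o Z_to_X K n) z = 0.
  by rewrite inE => zB; have /std_BP[] := cmap_B phi zB.
pose i : {linear Ht K n -> Q n} := descend _ zB.
have iE z : i (Z_to_H K n z) = pr2 n (phi n (Z_to_X K n z)) by apply: descend_pi.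
have [_ _] := rP n; move=> /(_ _ i); apply=> [|q].
  apply: linear_inj => h; have [z <-] := Z_to_H_surj h; rewrite iE => z2.
  apply/Z_to_H_eq0/(CE_ses_B ses).
  by apply/std_BP.
split=> [rq|[h]].
  have [_ _ /(_ q)[c fq]] := fP n; rewrite rq => /Z_to_H_eq0.
  rewrite -fq => /(cover_B fP ps)[s sE].
  have [||k kZ kE] := @CE_ses_Z_ker _ _ _ _ _ _ ses n (std2 n q - std1 n s).
  - by apply/std_ZP; rewrite linearB subrr.
  - by rewrite linearB sE subrr.
  have /Z_to_XP[z zk] := kZ; exists (Z_to_H K n z); rewrite iE zk kE.
  by rewrite linearB subr0.
have [z <-] := Z_to_H_surj h; rewrite iE => <-.
apply: (cover_B_pr2 fP); first by apply/std_ZP.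
by rewrite (CE_ses_comp ses) rpred0.
Qed.

(** Embed the boundaries and homology of K into modules of W.  Extending
    B_n(K) -> S (n + 1) to K_n uses Ext^1(K_n / B_n, W) = 0, and extending
    Z_n(K) -> H_n(K) -> Q n to K_n uses Ext^1(B_(n-1), W) = 0.  The resulting
    chain map f is injective, and its cokernel L has
    B_n(L) = Coker (B_n(K) -> S (n + 1)) and
    H_n(L) = Coker (H_n(K) -> Q n). *)
Lemma cosyzygy_step (K : complex R) : BH_Gorenstein K ->
  exists (L V : complex R) (phi : chain_map K V) (pi : chain_map V L),
  [/\ CE_class W V, CE_short_exact phi pi & BH_Gorenstein L].
Proof.
move=> GK.
have /dep_choice[S /dep_choice[i iP]] m := Gorenstein_cosyzygy (GK (m - 1)).1.
have /dep_choice[Q /dep_choice[j jP]] n := Gorenstein_cosyzygy (GK n).2.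
have WS m : W (S m) by have [] := iP m.
have WQ m : W (Q m) by have [] := jP m.
have ii m : injective (i m) by have [] := iP m.
have ji m : injective (j m) by have [] := jP m.
pose ga m : {linear K m -> S m} := i m \o X_to_B K (eq_succ_pred m).
have ga0 m x : ga m x = 0 <-> x \in Zsub K m.
  rewrite -(X_to_B_eq0 (eq_succ_pred m)); split=> [h|]; first exact: (inj0 (ii m)) h.
  by rewrite /ga /= => ->; rewrite linear0.
have /dep_choice[al alP] n : exists al : {linear K n -> S (n + 1)},
    forall x, al (d_to K n x) = ga (n + 1) x.
  have [x /X_to_B_eq0 xZ|k kP] :=
    @factor_surj _ _ _ _ (X_to_B K erefl) (ga (n + 1)) (@X_to_B_surj _ K _ n erefl).
    exact/ga0.
  have [inj ex sur] := short_exact_BXXB K n.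
  have [b b0|al alP] := (BH_ext1 GK (WS (n + 1)) n).2 _ _ _ _ ex sur k.
    by rewrite (inj0 inj b0) linear0.
  by exists al => x; rewrite -kP -alP.
have /dep_choice[be beP] n : exists be : {linear K n -> Q n},
    forall z, be (Z_to_X K n z) = j n (Z_to_H K n z).
  have [inj ex sur] := short_exact_ZXB K (eq_succ_pred n).
  apply: (Gorenstein_ext1 extWW (GK (n - 1)).1 (WQ n) ex sur (h := j n \o Z_to_H K n)).
  by move=> z /(inj0 inj) ->; apply: linear0.
have [n x xB|f fP] := chain_map_to_std al (be := be).
  have /Z_to_XP[z zx] := sub_BZ xB; rewrite -zx beP (Z_to_H_eq0 _).2 ?linear0 //.
  by rewrite zx.
have f1 n x : pr1 n (f n x) = al n x by have [] := fP n x.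
have f2 n x : pr2 n (f n x) = be n x by have [] := fP n x.
have f3 n x : pr3 n (f n x) = ga n x.
  apply: (can_inj (transportK (eq_succ_pred n) (esym (eq_succ_pred n)))).
  rewrite -to_std_pr3 f1; move: (n - 1) (eq_succ_pred n) => m e; subst n.
  by rewrite -alP.
have fB n y : f n (d_to K n y) = std1 n (ga (n + 1) y).
  by rewrite cmap_diff std_d_to f3.
have fkB n k : pr2 n (f n k) = 0 -> pr3 n (f n k) = 0 ->
    exists2 y, k = d_to K n y & f n k = std1 n (ga (n + 1) y).
  rewrite f2 f3 => k2 /ga0/Z_to_XP[z zk]; move: k2; rewrite -zk beP.
  move=> /(inj0 (ji n))/Z_to_H_eq0/(BsubP erefl)[y <-].
  by exists y => //; apply: fB.
have finj n : injective (f n).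
  apply: linear_inj => k fk; have [|| y kE] := @fkB n k; rewrite ?fk ?linear0 //.
  move=> /esym/(congr1 (pr1 n)); rewrite linear0 => /ga0/(ZsubP erefl) dy.
  by rewrite kE.
have [L [pi piP]] := cokernel_complex f.
have fB' n k s : f n k = std1 n s -> exists y, ga (n + 1) y = s.
  move=> fk; have [|| y _] := @fkB n k; rewrite fk //.
  by move=> /(congr1 (pr1 n)) sy; exists y.
have piZ n l : l \in Zsub L n -> exists2 v, v \in Zsub (std S Q) n & pi n v = l.
  have [ex sur] := piP n; have [v <-] := sur l.
  move=> /(ZsubP (eq_succ_pred n)); rewrite -cmap_diff => /(proj1 (piP _))[k].
  rewrite std_diffE => /fB'[y gy].
  have [y' gy'] : exists y', ga n y' = pr3 n v.
    by move: (n - 1) (eq_succ_pred n) y gy => m e; subst n => y /= <-; exists y.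
  exists (v - f n y'); first by apply/std_ZP; rewrite linearB f3 gy' subrr.
  by rewrite linearB (_ : pi n (f n y') = 0) ?subr0 //; apply/ex; exists y'.
have ses : CE_short_exact f pi.
  by split=> // n; have [ex sur] := piP n; split.
exists L, (std S Q), f, pi; split=> //; first exact: std_CE_class.
move=> n; have [ex sur] := piP n; split.
  have [_ _] := iP (n + 1).
  pose b := corestrict (pi n \o std1 n) (fun s => cmap_B pi (std1_B s)).
  move=> /(_ _ b); apply=> [s|l].
    split=> [/(congr1 (B_to_X L n)) /ex[k /fB'[y <-]]|[c <-]].
      by exists (X_to_B K (eq_succ_pred (n + 1)) y).
    have [y <-] := X_to_B_surj (eq_succ_pred (n + 1)) c.
    apply: subm_val_inj; rewrite [LHS](_ : _ = pi n (std1 n (ga (n + 1) y))) //.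
    by rewrite -fB; apply/ex; exists (d_to K n y).
  have /B_to_XP/(BsubP erefl)[l' lE] : exists c, B_to_X L n c = B_to_X L n l.
    by exists l.
  have [v vl'] := (proj2 (piP (n + 1))) l'; exists (pr3 (n + 1) v).
  apply: subm_val_inj; rewrite -[RHS]lE -vl' -cmap_diff std_d_to.
  by [].
pose c := corestrict (pi n \o std2 n) (fun q => cmap_Z pi (std2_Z q)).
pose h := Z_to_H L n \o c.
have h0 q : h q = 0 <-> pi n (std2 n q) \in Bsub L n by apply: Z_to_H_eq0.
have [_ _] := jP n; move=> /(_ _ h); apply=> [q|u].
  rewrite h0; split=> [/(CE_ses_pre_B ses)[k [b /std_BP[b2 b3] qE]]|[w <-]].
    have /ga0/Z_to_XP[z zk] : ga n k = 0.
      by rewrite -f3 -[LHS]addr0 -{1}b3 -linearD -qE.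
    exists (Z_to_H K n z); rewrite -beP zk -f2 -[LHS]addr0 -{1}b2 -linearD -qE.
    by [].
  have [z <-] := Z_to_H_surj w; rewrite -beP -f2.
  have -> : pi n (std2 n (pr2 n (f n (Z_to_X K n z)))) =
      pi n (std2 n (pr2 n (f n (Z_to_X K n z))) - f n (Z_to_X K n z)).
    by rewrite linearB (CE_ses_comp ses) subr0.
  apply/cmap_B/std_BP; rewrite !linearB f3 (ga0 _ _).2 ?subrr //.
  by apply/Z_to_XP; exists z.
have [l <-] := Z_to_H_surj u.
have [|v /std_ZP v3 vl] := piZ n (Z_to_X L n l); first by apply/Z_to_XP; exists l.
exists (pr2 n v); apply: subr0_eq.
apply: etrans (esym (linearB (Z_to_H L n) (c (pr2 n v)) l)) _.
apply/Z_to_H_eq0; rewrite linearB -vl -[X in X - _]/(pi n (std2 n (pr2 n v))).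
rewrite -linearB; apply/cmap_B/std_BP; rewrite !linearB v3 subr0.
by split; first exact: subrr.
Qed.

End Resolutions.

(** * Splicing a complete resolution *)

Lemma bi_infinite_sequence (T : Type) (r : T -> T -> Prop) (t0 : T) :
    (forall t, exists u, r t u) -> (forall t, exists u, r u t) ->
  exists f : int -> T, f (-1) = t0 /\ forall p q, p = q + 1 -> r (f p) (f q).
Proof.
move=> /choice[g gP] /choice[h hP].
exists (fun z => match z with Posz n => iter n.+1 h t0 | Negz n => iter n g t0 end).
split=> // p q ->; case: q => [n|[|n]].
- by rewrite -PoszD addn1; apply: hP.
- exact: hP.
- by rewrite NegzE -addn1 PoszD opprD subrK -NegzE; apply: gP.
Qed.

Section Construction.
Variables (R : pzRingType) (W : lmodType R -> Prop).
Hypothesis extWW : forall V V', W V -> W V' -> ext1_vanishes V V'.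
Hypothesis hext : closed_extensions W.
Hypothesis hsum : closed_finite_direct_sums W.

(** The syzygies K p satisfy 0 -> K p -> V p -> K (p - 1) -> 0 with
    K (-1) = G, and the differential of the resolution is the composite
    V p -> K (p - 1) -> V (p - 1). *)
Lemma BH_Gorenstein_resolution (G : complex R) :
  BH_Gorenstein W G -> exists C : ccomplex R, CE_complete_resolution W G C.
Proof.
move=> GG.
pose link (K L : {X | BH_Gorenstein W X}) :=
  exists (V : complex R) (phi : chain_map (sval K) V)
         (pi : chain_map V (sval L)), CE_class W V /\ CE_short_exact phi pi.
have linkR K : exists L, link K L.
  have [L [V [phi [pi [WV ses GL]]]]] := cosyzygy_step extWW hext hsum (svalP K).
  by exists (exist _ L GL), V, phi, pi.
have linkL L : exists K, link K L.
  have [K [V [phi [pi [WV ses GK]]]]] := syzygy_step extWW hext hsum (svalP L).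
  by exists (exist _ K GK), V, phi, pi.
have [K' [KG Klink]] := bi_infinite_sequence (exist _ G GG) linkR linkL.
pose K p := sval (K' p).
(* Indexing pi by q and a proof of p = q + 1 matches the differential of a
   complex of complexes, so that the composites need no transport. *)
have /dep_choice[V /dep_choice[phi /dep_choice[pi piP]]] p :
  exists (V : complex R) (phi : chain_map (K p) V)
         (pi : forall q, p = q + 1 -> chain_map V (K q)),
  CE_class W V /\ forall q e, CE_short_exact phi (pi q e).
  have [V [phi [pi [WV ses]]]] := Klink p (p - 1) (eq_succ_pred p).
  exists V, phi.
  suff /dep_choice[F FP] q : exists F : p = q + 1 -> chain_map V (K q),
      forall e, CE_short_exact phi (F e) by exists F.
  apply: (@dep_choice _ _ (fun _ F => CE_short_exact phi F)) => e.
  have qE := eq_pred e; subst q.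
  by exists pi.
have ses p q e := (piP p).2 q e.
have WV p := (piP p).1.
pose C := @CComplex R V (fun p q e => comp_chain (phi q) (pi p q e))
  (fun p q r epq eqr n x =>
    etrans (congr1 (phi r n) (CE_ses_comp (ses q r eqr) (pi p q epq n x)))
      (linear0 _)).
have GK p : BH_Gorenstein W (K p) := svalP (K' p).
have piS p q e n : surj (pi p q e n) by have [_ _] := (ses p q e).1 n.
have phiI p n : injective (phi p n) by have [] := (ses p _ (eq_succ_pred p)).1 n.
suff: CE_complete_resolution W (K (-1)) C by rewrite /K KG; exists C.
split=> //.
- move=> p n.
  pose sp := (ses (p + 1) p erefl, ses p _ (eq_succ_pred p), ses _ _ (eq_succ_pred (p - 1))).
  have aE m x : cd_to C p m x = phi p m (pi _ _ erefl m x) by [].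
  have bE m x : cd_from C p m x = phi _ m (pi _ _ (eq_succ_pred p) m x).
    by rewrite (eq_irrelevance (eq_succ_pred p) (esym (subrK 1 p))).
  split; split.
  + exact: (splice_exact sp.1.1 sp.1.2 sp.2 aE bE).
  + exact: (splice_exact_Z sp.1.1 sp.1.2 sp.2 aE bE).
  + exact: (splice_exact_B sp.1.1 sp.1.2 sp.2 aE bE).
  + exact: (splice_exact_XZ sp.1.1 sp.1.2 sp.2 aE bE).
  + exact: (splice_exact_XB sp.1.1 sp.1.2 sp.2 aE bE).
  + exact: (splice_exact_H sp.1.1 sp.1.2 sp.2 aE bE).
- exists (phi (-1)) => n; split; first exact: phiI.
  have [_ ex _] := (ses (-1) _ (esym (subrK 1 (-1)))).1 n.
  move=> y; rewrite -ex; split=> [/(inj0 (@phiI _ n)) //|y0].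
  by rewrite /= y0 linear0.
- move=> T WT p f f0.
  have fpi n v : pi _ _ (esym (subrK 1 p)) n (f n v) = 0.
    exact: (inj0 (@phiI _ n) (f0 n v)).
  have /dep_choice[f' f'P] n :
      exists f' : {linear T n -> K p n}, forall v, phi p n (f' v) = f n v.
    apply: (@factor_inj _ _ _ _ (phi p n) (f n)) => // v.
    by have [_ ex _] := (ses p _ (esym (subrK 1 p))).1 n; apply/ex.
  have f'd i j (e : i = j + 1) x : f' j (diff T e x) = diff (K p) e (f' i x).
    by apply: (@phiI p); rewrite f'P !cmap_diff f'P.
  have [|g gP] := CE_lift extWW (ses (p + 1) p erefl) _ WT (ChainMap f'd).
    by move=> U WU n; have [? ? _] := BH_lifts extWW (GK (p + 1)) WU n.
  by exists g => n v; rewrite -f'P -gP.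
- move=> T WT p f f0.
  have fphi n x : f n (phi p n x) = 0.
    by have [y <-] := piS _ _ (erefl (p + 1)) n x; apply: f0.
  have /dep_choice[f' f'P] n : exists f' : {linear K (p - 1) n -> T n},
      forall v, f' (pi _ _ (esym (subrK 1 p)) n v) = f n v.
    apply: (@factor_surj _ _ _ _ _ (f n)) => // v pv.
    have [_ ex _] := (ses p _ (esym (subrK 1 p))).1 n.
    by have [k <-] := (ex v).1 pv; apply: fphi.
  have f'd i j (e' : i = j + 1) x :
      f' j (diff (K (p - 1)) e' x) = diff T e' (f' i x).
    have [y <-] := piS _ _ (esym (subrK 1 p)) i x.
    by rewrite -cmap_diff !f'P cmap_diff.
  have [|g gP] := CE_extend extWW (ses (p - 1) _ (esym (subrK 1 (p - 1)))) _
      WT (ChainMap f'd).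
    by move=> U WU n; apply: BH_ext1 (GK _) WU n.
  by exists g => n v; rewrite -f'P -gP.
Qed.
End Construction.

(** * Hom-exactness of the components of a resolution *)

Section TwoOutOfThree.
Variables (R : pzRingType) (A B C : complex R) (V : lmodType R).
Variables (i : chain_map A B) (p : chain_map B C).
Hypothesis ses : forall n, short_exact (i n) (p n).

(** Lift f : V -> C n to B n; the differential of the lift comes from A (n - 1),
    where it is a cocycle, hence a coboundary.  Correcting the lift accordingly
    makes it a cocycle, hence a coboundary, in B. *)
Lemma Hom_from_quotient : (forall n, lifts V (A n)) ->
  Hom_from_exact V A -> Hom_from_exact V B -> Hom_from_exact V C.
Proof.
move=> liftA fromA fromB n f f0.
have [inj ex sur] := ses n; have [inj' ex' sur'] := ses (n - 1).
have [v|f1 f1P] := liftA n _ _ _ _ inj ex f; first exact: sur.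
have [v|w wP] := @factor_inj _ _ _ _ (i (n - 1)) (d_from B n \o f1) inj'.
  by apply/ex'; rewrite /= cmap_diff f1P; apply: f0.
have [v|w' w'P] := Hom_from_diff (esym (subrK 1 n))
    (e2 := esym (subrK 1 (n - 1))) (f := w) fromA.
  have [inj'' _ _] := ses (n - 1 - 1); apply: (inj0 inj'').
  by rewrite cmap_diff wP /= diff_diff.
have [v|g gP] := fromB n (f1 \- (i n \o w')).
  by rewrite linearB /= /d_from -cmap_diff w'P wP /= subrr.
exists (p (n + 1) \o g) => v; rewrite /= -cmap_diff -/(d_to B n) gP linearB f1P /=.
have -> : p n (i n (w' v)) = 0 by apply/ex; exists (w' v).
by rewrite subr0.
Qed.

(** Dual to [Hom_from_quotient]: an extension of f to B n is corrected by a
    map on C n so as to become a cocycle of Hom(B, V). *)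
Lemma Hom_to_sub : (forall n, ext1_vanishes (C n) V) ->
  Hom_to_exact B V -> Hom_to_exact C V -> Hom_to_exact A V.
Proof.
move=> extC toB toC n f f0.
have [inj ex sur] := ses n; have [inj' ex' sur'] := ses (n + 1).
have [a /(inj0 inj) ->|f1 f1P] := extC n _ _ _ _ ex sur f; first exact: linear0.
have [b /ex'[a <-]|w wP] := @factor_surj _ _ _ _ (p (n + 1)) (f1 \o d_to B n) sur'.
  by rewrite /= /d_to -cmap_diff f1P; apply: f0.
have [c|w' w'P] := Hom_to_diff (e1 := (erefl : n + 1 + 1 = _))
    (erefl : n + 1 = _) (f := w) toC.
  have [_ _ sur''] := ses (n + 1 + 1); have [b <-] := sur'' c.
  by rewrite -cmap_diff wP /= /d_to diff_diff linear0.
have [b|g gP] := toB n (f1 \- (w' \o p n)).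
  by rewrite /= /d_to cmap_diff w'P wP /= subrr.
exists (g \o i (n - 1)) => a; rewrite /= cmap_diff -/(d_from B n) gP /= f1P.
have -> : p n (i n a) = 0 by apply/ex; exists a.
by rewrite linear0 subr0.
Qed.

End TwoOutOfThree.

Section ComponentComplexes.
Variables (R : pzRingType) (C : ccomplex R) (n : int).

Definition Xcpx : complex R :=
  @Complex R (fun p => C p n) (fun p q e => cdiff C e n)
    (fun p q r epq eqr => @cdiff_diff R C p q r epq eqr n).

Lemma Zmap_comp p q r (epq : p = q + 1) (eqr : q = r + 1) x :
  Zmap (cdiff C eqr) n (Zmap (cdiff C epq) n x) = 0.
Proof. by apply: subm_val_inj; apply: cdiff_diff. Qed.

Definition Zcpx : complex R :=
  @Complex R (fun p => Zt (C p) n) (fun p q e => Zmap (cdiff C e) n) Zmap_comp.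

Lemma Bmap_comp p q r (epq : p = q + 1) (eqr : q = r + 1) x :
  Bmap (cdiff C eqr) n (Bmap (cdiff C epq) n x) = 0.
Proof. by apply: subm_val_inj; apply: cdiff_diff. Qed.

Definition Bcpx : complex R :=
  @Complex R (fun p => Bt (C p) n) (fun p q e => Bmap (cdiff C e) n) Bmap_comp.

Lemma Hmap_comp p q r (epq : p = q + 1) (eqr : q = r + 1) x :
  Hmap (cdiff C eqr) n (Hmap (cdiff C epq) n x) = 0.
Proof.
by have [z <-] := Z_to_H_surj x; rewrite !Hmap_pi Zmap_comp linear0.
Qed.

Definition Hcpx : complex R :=
  @Complex R (fun p => Ht (C p) n) (fun p q e => Hmap (cdiff C e) n) Hmap_comp.

Lemma XBmap_comp p q r (epq : p = q + 1) (eqr : q = r + 1) x :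
  XBmap (cdiff C eqr) n (XBmap (cdiff C epq) n x) = 0.
Proof.
by have [z <-] := X_to_XB_surj x; rewrite !XBmap_pi cdiff_diff linear0.
Qed.

Definition XBcpx : complex R :=
  @Complex R (fun p => XBt (C p) n) (fun p q e => XBmap (cdiff C e) n) XBmap_comp.

Lemma B_to_Z_comm p q (e : p = q + 1) x :
  B_to_Z (C q) n (Bmap (cdiff C e) n x) = Zmap (cdiff C e) n (B_to_Z (C p) n x).
Proof. exact: subm_val_inj. Qed.

Definition B_to_Z_cpx : chain_map Bcpx Zcpx :=
  @ChainMap R Bcpx Zcpx (fun p => B_to_Z (C p) n) B_to_Z_comm.

Definition Z_to_H_cpx : chain_map Zcpx Hcpx :=
  @ChainMap R Zcpx Hcpx (fun p => Z_to_H (C p) n)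
    (fun p q e x => esym (Hmap_pi (cdiff C e) x)).

Definition B_to_X_cpx : chain_map Bcpx Xcpx :=
  @ChainMap R Bcpx Xcpx (fun p => B_to_X (C p) n) (fun p q e x => erefl).

Definition Z_to_X_cpx : chain_map Zcpx Xcpx :=
  @ChainMap R Zcpx Xcpx (fun p => Z_to_X (C p) n) (fun p q e x => erefl).

Definition X_to_XB_cpx : chain_map Xcpx XBcpx :=
  @ChainMap R Xcpx XBcpx (fun p => X_to_XB (C p) n)
    (fun p q e x => esym (XBmap_pi (cdiff C e) x)).

Lemma H_to_XB_comm p q (e : p = q + 1) x :
  H_to_XB (C q) n (Hmap (cdiff C e) n x) =
  XBmap (cdiff C e) n (H_to_XB (C p) n x).
Proof.
have [z <-] := Z_to_H_surj x.
by rewrite Hmap_pi !H_to_XBE XBmap_pi.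
Qed.

Definition H_to_XB_cpx : chain_map Hcpx XBcpx :=
  @ChainMap R Hcpx XBcpx (fun p => H_to_XB (C p) n) H_to_XB_comm.

End ComponentComplexes.

Section Differential.
Variables (R : pzRingType) (C : ccomplex R) (m n : int) (d : m = n + 1).

Lemma X_to_B_comm p q (e : p = q + 1) x :
  X_to_B (C q) d (cdiff C e m x) = Bmap (cdiff C e) n (X_to_B (C p) d x).
Proof. by apply: subm_val_inj; apply/esym/cmap_diff. Qed.

Definition X_to_B_cpx : chain_map (Xcpx C m) (Bcpx C n) :=
  @ChainMap R (Xcpx C m) (Bcpx C n) (fun p => X_to_B (C p) d) X_to_B_comm.

Lemma XB_to_B_comm p q (e : p = q + 1) x :
  XB_to_B (C q) d (XBmap (cdiff C e) m x) =
  Bmap (cdiff C e) n (XB_to_B (C p) d x).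
Proof.
have [z <-] := X_to_XB_surj x.
by rewrite XBmap_pi !XB_to_BE X_to_B_comm.
Qed.

Definition XB_to_B_cpx : chain_map (XBcpx C m) (Bcpx C n) :=
  @ChainMap R (XBcpx C m) (Bcpx C n) (fun p => XB_to_B (C p) d) XB_to_B_comm.

End Differential.

(** A map defined in the single degree n is extended by zero, to serve as one
    component of a chain map with [std (fun=> V) (fun=> V)]. *)
Lemma extend_by_default (T : int -> Type) (P : forall m, T m -> Prop) n (x : T n)
    (dflt : forall m, T m) :
    P n x -> (forall m, P m (dflt m)) ->
  exists t : forall m, T m, t n = x /\ forall m, P m (t m).
Proof.
move=> Px Pd.
have /dep_choice[t tP] m : exists t : T m,
    P m t /\ forall e : n = m, t = ecast m (T m) e x.
  have [e|ne] := pselect (n = m); last by exists (dflt m); split=> // e.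
  by subst m; exists x; split=> // e; rewrite (eq_irrelevance e erefl).
by exists t; split=> [|m]; [have [_ /(_ erefl)] := tP n|have [] := tP m].
Qed.

Section Converse.
Variables (R : pzRingType) (W : lmodType R -> Prop).
Hypothesis extWW : forall V V', W V -> W V' -> ext1_vanishes V V'.
Hypothesis hext : closed_extensions W.
Hypothesis hsum : closed_finite_direct_sums W.
Variable C : ccomplex R.
Hypothesis WC : forall p, CE_class W (C p).
Hypothesis fromC : forall V, CE_class W V -> cHom_from_exact V C.
Hypothesis toC : forall V, CE_class W V -> cHom_to_exact C V.

Variable V : lmodType R.
Hypothesis WV : W V.

Let T := std (fun=> V) (fun=> V).

Lemma test_CE_class : CE_class W T.
Proof. exact: std_CE_class. Qed.

Definition zero_chain (X Y : complex R) : chain_map X Y :=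
  @ChainMap R X Y (fun n => \0) (fun i j e x => esym (linear0 (diff Y e))).

Lemma Hom_from_X n : Hom_from_exact V (Xcpx C n).
Proof.
move=> p f f0.
have [|t [tn t0]] := @extend_by_default (fun m => {linear V -> C p m})
   (fun m t => forall v, cd_from C p m (t v) = 0) n f (fun m => \0) f0.
  by move=> m v; apply: linear0.
have [F FP] := chain_map_from_std t (fun m => \0 : {linear V -> Zt (C p) m}).
have [|g gP] := fromC test_CE_class (f := F).
  move=> m v; have [F1 F2 F3] := FP m; rewrite [v]stdE !linearD F1 F2 F3 !linear0 t0.
  by rewrite /d_to cmap_diff t0 linear0 !addr0.
exists (g n \o std3 n) => v; rewrite -tn; have [_ _ <-] := FP n.
exact: gP.
Qed.

Lemma Hom_from_Z n : Hom_from_exact V (Zcpx C n).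
Proof.
move=> p f f0.
have [|t [tn t0]] := @extend_by_default (fun m => {linear V -> Zt (C p) m})
   (fun m t => forall v, Zmap (cd_from C p) m (t v) = 0) n f (fun m => \0) f0.
  by move=> m v; apply: linear0.
have [F FP] := chain_map_from_std (fun m => \0 : {linear V -> C p m}) t.
have [|g gP] := fromC test_CE_class (f := F).
  move=> m v; have [F1 F2 F3] := FP m; rewrite [v]stdE !linearD F1 F2 F3 !linear0.
  by rewrite add0r addr0; have /(congr1 (Z_to_X _ m)) := t0 m (pr2 m v).
exists (corestrict (g n \o std2 n) (fun v => cmap_Z g (std2_Z v))) => v.
apply: subm_val_inj; rewrite -tn; have [_ F2 _] := FP n.
by rewrite -[RHS]F2 -gP.
Qed.

Lemma Hom_from_B n : Hom_from_exact V (Bcpx C n).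
Proof.
apply: (@Hom_from_quotient _ _ _ _ _ (Z_to_X_cpx C (n + 1)) (X_to_B_cpx C erefl)).
- by move=> p; apply: short_exact_ZXB.
- by move=> p; apply/ext1_vanishes_lifts/extWW => //; have [] := WC p (n + 1).
- exact: Hom_from_Z.
- exact: Hom_from_X.
Qed.

Lemma Hom_from_H n : Hom_from_exact V (Hcpx C n).
Proof.
apply: (@Hom_from_quotient _ _ _ _ _ (B_to_Z_cpx C n) (Z_to_H_cpx C n)).
- by move=> p; apply: short_exact_BZH.
- by move=> p; apply/ext1_vanishes_lifts/extWW => //; have [] := WC p n.
- exact: Hom_from_B.
- exact: Hom_from_Z.
Qed.

Lemma Hom_to_X n : Hom_to_exact (Xcpx C n) V.
Proof.
move=> p f f0.
have [|t [tn t0]] := @extend_by_default (fun m => {linear C p m -> V})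
   (fun m t => forall x, t (cd_to C p m x) = 0) n f (fun m => \0) f0.
  by move=> m v.
have [//|F FP] := chain_map_to_std (S := fun=> V) t (be := fun m => \0 : {linear C p m -> V}).
have [|g gP] := toC test_CE_class (f := F).
  apply: (to_std_ext (f := comp_chain F (cd_to C p)) (g := zero_chain _ _)) => m x;
  rewrite comp_chainE; have [e1 e2] := FP m (cd_to C p m x).
    by rewrite e1 t0.
  by rewrite e2.
by exists (pr1 n \o g n) => x; rewrite -tn; have [<- _] := FP n x; rewrite -gP.
Qed.

Lemma Hom_to_XB n : Hom_to_exact (XBcpx C n) V.
Proof.
move=> p f f0.
have [|t [tn t0]] := @extend_by_default (fun m => {linear XBt (C p) m -> V})
   (fun m t => forall x, t (XBmap (cd_to C p) m x) = 0) n f (fun m => \0) f0.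
  by move=> m v.
have [m x /quom_pi_eq0 xB|F FP] := chain_map_to_std (S := fun=> V)
  (fun m => \0 : {linear C p m -> V}) (be := fun m => t m \o X_to_XB _ m).
  by rewrite /= [X_to_XB _ _ _]xB linear0.
have [|g gP] := toC test_CE_class (f := F).
  apply: (to_std_ext (f := comp_chain F (cd_to C p)) (g := zero_chain _ _)) => m x;
  rewrite comp_chainE; have [e1 e2] := FP m (cd_to C p m x).
    by rewrite e1.
  by rewrite e2 /= -XBmap_pi t0.
exists (descend (pr2 n \o g n) (@to_std_B _ _ _ _ g n)) => u.
have [x <-] := X_to_XB_surj u; rewrite -tn.
have [_ e2] := FP n x; rewrite -[RHS]e2 -gP [d_from _ _ _]XBmap_pi.
exact: descend_pi.
Qed.

Lemma W_XB p n : W (XBt (C p) n).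
Proof.
apply: class_short_exact (short_exact_HXBB (C p) (eq_succ_pred n)) _ _ => //.
  by have [] := WC p n.
by have [] := WC p (n - 1).
Qed.

Lemma Hom_to_B n : Hom_to_exact (Bcpx C n) V.
Proof.
apply: (@Hom_to_sub _ _ _ _ _ (B_to_X_cpx C n) (X_to_XB_cpx C n)).
- by move=> p; apply: short_exact_BXXB.
- by move=> p; apply: extWW => //; apply: W_XB.
- exact: Hom_to_X.
- exact: Hom_to_XB.
Qed.

Lemma Hom_to_Z n : Hom_to_exact (Zcpx C n) V.
Proof.
apply: (@Hom_to_sub _ _ _ _ _ (Z_to_X_cpx C n) (X_to_B_cpx C (eq_succ_pred n))).
- by move=> p; apply: short_exact_ZXB.
- by move=> p; apply: extWW => //; have [] := WC p (n - 1).
- exact: Hom_to_X.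
- exact: Hom_to_B.
Qed.

Lemma Hom_to_H n : Hom_to_exact (Hcpx C n) V.
Proof.
apply: (@Hom_to_sub _ _ _ _ _ (H_to_XB_cpx C n) (XB_to_B_cpx C (eq_succ_pred n))).
- by move=> p; apply: short_exact_HXBB.
- by move=> p; apply: extWW => //; have [] := WC p (n - 1).
- exact: Hom_to_XB.
- exact: Hom_to_B.
Qed.

End Converse.

(** * Kernels of the components, and the equivalence *)

Section KernelComponents.
Variables (R : pzRingType) (G : complex R) (C : ccomplex R).
Hypothesis CE_C : CE_exact C.
Variable k : chain_map G (C (-1)).
Hypothesis kP : forall n, injective (k n) /\ exact (k n) (cd_from C (-1) n).
Variable n : int.

Lemma kernel_comp g : cd_from C (-1) n (k n g) = 0.
Proof. by have [_ ex] := kP n; apply/ex; exists g. Qed.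

Lemma kernel_Z g : k n g \in Zsub (C (-1)) n -> g \in Zsub G n.
Proof.
rewrite !(ZsubP (eq_succ_pred n)) -cmap_diff; have [inj _] := kP (n - 1).
exact: inj0.
Qed.

(** A boundary of C (-1) lying in G need not a priori be a boundary of G.  By
    exactness of B(C) it is d of an element coming from C 0, and that element
    already lies in G. *)
Lemma kernel_B_lift y : y \in Bsub (C (-1)) n -> cd_from C (-1) n y = 0 ->
  exists2 g, g \in Bsub G n & k n g = y.
Proof.
move=> /B_to_XP[b <-] b0; have [[_ _ exB] _] := CE_C (-1) n.
have /exB[x xb] : Bmap (cd_from C (-1)) n b = 0 by apply: subm_val_inj.
have /B_to_XP/(BsubP erefl)[w wx] : exists z, B_to_X _ n z = B_to_X _ n x by exists x.
have [[ex _ _] _] := CE_C (-1) (n + 1); have [_ exk] := kP (n + 1).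
have /exk[g gw] : cd_from C (-1) (n + 1) (cd_to C (-1) (n + 1) w) = 0.
  by apply/ex; exists w.
exists (diff G erefl g); first exact: diff_B.
by rewrite cmap_diff gw -cmap_diff wx -xb.
Qed.

Lemma kernel_B g : k n g \in Bsub (C (-1)) n -> g \in Bsub G n.
Proof.
move=> /kernel_B_lift/(_ (kernel_comp g))[g' g'B].
by have [inj _] := kP n => /inj <-.
Qed.

Lemma kernel_Z_exact :
  injective (Zmap k n) /\ exact (Zmap k n) (d_from (Zcpx C n) (-1)).
Proof.
have [inj ex] := kP n; split.
  by move=> x y /(congr1 (Z_to_X _ n))/inj xy; apply: subm_val_inj.
move=> y; split=> [/(congr1 (Z_to_X _ n))/ex[g gy]|[g <-]].
  have /kernel_Z/Z_to_XP[z zg] : k n g \in Zsub (C (-1)) n.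
    by rewrite gy; apply/Z_to_XP; exists y.
  by exists z; apply: subm_val_inj; rewrite -[RHS]gy -zg.
by apply: subm_val_inj; apply: kernel_comp.
Qed.

Lemma kernel_B_exact :
  injective (Bmap k n) /\ exact (Bmap k n) (d_from (Bcpx C n) (-1)).
Proof.
have [inj ex] := kP n; split.
  by move=> x y /(congr1 (B_to_X _ n))/inj xy; apply: subm_val_inj.
move=> y; split=> [/(congr1 (B_to_X _ n)) y0|[g <-]].
  have /kernel_B_lift/(_ y0)[g /B_to_XP[b <-] gy] : B_to_X _ n y \in Bsub (C (-1)) n.
    by apply/B_to_XP; exists y.
  by exists b; apply: subm_val_inj.
by apply: subm_val_inj; apply: kernel_comp.
Qed.

Lemma kernel_H_exact :
  injective (Hmap k n) /\ exact (Hmap k n) (d_from (Hcpx C n) (-1)).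
Proof.
split.
  apply: linear_inj => h; have [z <-] := Z_to_H_surj h; rewrite Hmap_pi.
  by move=> /Z_to_H_eq0/kernel_B zB; apply/Z_to_H_eq0.
have [_ exZ] := kernel_Z_exact.
move=> u; split=> [|[h <-]].
  have [_ [_ _ exH]] := CE_C (-1) n.
  move=> /(exH u)[w <-]; have [z <-] := Z_to_H_surj w; rewrite Hmap_pi.
  have /exZ[g <-] : Zmap (cd_from C (-1)) n (Zmap (cd_to C (-1)) n z) = 0.
    exact: Zmap_comp.
  by exists (Z_to_H G n g); rewrite Hmap_pi.
have [z <-] := Z_to_H_surj h; rewrite Hmap_pi [LHS]Hmap_pi.
rewrite (_ : Zmap _ n _ = 0) ?linear0 //; apply/exZ; by exists z.
Qed.

End KernelComponents.

Lemma resolution_CE_Gorenstein (R : pzRingType) (W : lmodType R -> Prop)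
    (G : complex R) (C : ccomplex R) :
    (forall V V', W V -> W V' -> ext1_vanishes V V') ->
    closed_extensions W -> closed_finite_direct_sums W ->
  CE_complete_resolution W G C -> CE_Gorenstein W G.
Proof.
move=> extWW hext hsum [CE_C WC [k kP] fromC toC] n; split.
- exists (Xcpx C n), (k n); split=> [p|p||V WV|V WV].
  + by have [] := WC p n.
  + by have [[]] := CE_C p n.
  + exact: kP.
  + exact: (Hom_from_X hext hsum fromC WV).
  + exact: (Hom_to_X hext hsum toC WV).
- exists (Bcpx C n), (Bmap k n); split=> [p|p||V WV|V WV].
  + by have [] := WC p n.
  + by have [[]] := CE_C p n.
  + exact: kernel_B_exact.
  + exact: (Hom_from_B extWW hext hsum WC fromC WV).
  + exact: (Hom_to_B extWW hext hsum WC toC WV).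
- exists (Zcpx C n), (Zmap k n); split=> [p|p||V WV|V WV].
  + by have [] := WC p n.
  + by have [[]] := CE_C p n.
  + exact: kernel_Z_exact.
  + exact: (Hom_from_Z hext hsum fromC WV).
  + exact: (Hom_to_Z extWW hext hsum WC toC WV).
- exists (Hcpx C n), (Hmap k n); split=> [p|p||V WV|V WV].
  + by have [] := WC p n.
  + by have [_ []] := CE_C p n.
  + exact: kernel_H_exact.
  + exact: (Hom_from_H extWW hext hsum WC fromC WV).
  + exact: (Hom_to_H extWW hext hsum WC toC WV).
Qed.

Theorem theoremB (R : comPzRingType) (W : lmodType R -> Prop)
    (hW : self_orthogonal W)
    (hext : closed_extensions W)
    (hsum : closed_finite_direct_sums W)
    (hsummand : closed_direct_summands W)
    (G : complex R) :
  CE_Gorenstein W G <-> exists C : ccomplex R, CE_complete_resolution W G C.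
Proof.
have extWW V V' (WV : W V) (WV' : W V') : ext1_vanishes V V'.
  exact/ext1_vanishes_resolution/hW.
split=> [GG|[C resC]]; last exact: resolution_CE_Gorenstein resC.
by apply: BH_Gorenstein_resolution => // n; have [] := GG n.
Qed.
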